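(* Let $X$ be a real separable Banach space, and assume: (1) $Q:X^*\to X$ is linear, bounded, symmetric ($\langle Qx^*,y^*\rangle=\langle Qy^*,x^*\rangle$) and nonnegative ($\langle Qx^*,x^*\rangle\ge 0$), and $A:D(A)\subseteq X\to X$ generates a strongly continuous contraction semigroup $(e^{tA})_{t\ge0}$ on $X$; (2) for every $t>0$ the operator $Q_t:=\int_0^t e^{sA}Qe^{sA^*}\,ds$ is the covariance operator of a centred Gaussian measure on $X$; for every $x^*\in X^*$ the weak limit $Q_\infty x^*:=\lim_{t\to+\infty}Q_tx^*$ exists, and $Q_\infty$ is the covariance operator of a centred nondegenerate Gaussian measure $\mu_\infty$ on $X$; (3) for every $x^*\in D(A^* )$ one has $Q_\infty A^*x^*\in H$, and there is $c>0$ with $|Q_\infty A^*x^*|_H\le c\,|i^*x^*|_H$ for all $x^*\in D(A^* )$; (4) $U$ is a proper, $\|\cdot\|_X$-lower semicontinuous convex function on $X$ belonging to $W^{1,p}_H(X,\mu_\infty)$ for every $p\in[1,+\infty)$; set $\nu_\infty:=e^{-U}\mu_\infty$. For $p\in[1,+\infty)$ let $L_p$ be the infinitesimal generator of the perturbed Ornstein–Uhlenbeck semigroup $(T_p(t))_{t\ge0}$ on $L^p(X,\nu_\infty)$. Then for all $p,q\in(1,+\infty)$ with $q>p$ we have $D(L_q)\subset D(L_p)$ with continuous embedding (domains endowed with graph norms), and $L_qu=L_pu$ for every $u\in D(L_q)$. In particular, $D(L_p)\subset W^{1,2}_H(X,\nu_\infty)$ with continuous embedding for every $p\ge2$.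
   Context: $H$ is the Reproducing Kernel Hilbert Space of $Q$: the completion of $QX^*$ under $[Qx^*,Qy^*]_H:=\langle Qx^*,y^*\rangle_{X\times X^*}$, continuously embedded in $X$ by $i:H\to X$; $i^*:X^*\to H$ is the adjoint (with $H^*\cong H$), and $Q=i\circ i^*$. By (3) and the density of $i^*D(A^* )$ in $H$ there is a unique $B\in\mathcal L(H)$ with $Bi^*x^*=Q_\infty A^*x^*$ for all $x^*\in D(A^* )$; it is known that $B+B^*=-\mathrm{Id}_H$. $\mathscr{FC}_b^{k}(X)$ is the set of functions $f(x)=\varphi(\langle x,x_1^*\rangle,\dots,\langle x,x_n^*\rangle)$ with $n\in\mathbb N$, $\varphi\in C_b^k(\mathbb R^n)$ (bounded and continuous with bounded continuous derivatives up to order $k$), $x_j^*\in X^*$. For such $f$ with $k=1$, $D_Hf(x):=i^*Df(x)=\sum_{j}\frac{\partial\varphi}{\partial\xi_j}(\langle x,x_1^*\rangle,\dots,\langle x,x_n^*\rangle)\,i^*x_j^*$. Under (1)–(3), $D_H$ is known to be closable in $L^p(X,\mu_\infty)$; $W^{1,p}_H(X,\mu_\infty)$ is the domain of the closure (still denoted $D_H$). Under (1)–(4), $e^{-U}\in W^{1,p}_H(X,\mu_\infty)$ for all $p\in[1,+\infty)$, so $\nu_\infty$ is a finite measure, and $D_H:\mathscr{FC}_b^1(X)\to L^p(X,\nu_\infty;H)$ is closable in $L^p(X,\nu_\infty)$ for $p\in(1,+\infty)$; $W^{1,p}_H(X,\nu_\infty)$ is the domain of its closure (still denoted $D_H$),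 with norm $\|f\|_{L^p(X,\nu_\infty)}+\|D_Hf\|_{L^p(X,\nu_\infty;H)}$. The form $\mathcal E(u,v):=-\int_X[BD_Hu,D_Hv]_H\,d\nu_\infty$ with domain $W^{1,2}_H(X,\nu_\infty)$ is a (nonsymmetric) coercive closed form on $L^2(X,\nu_\infty)$. The associated operator $L_2$ has domain the set of $u\in W^{1,2}_H(X,\nu_\infty)$ for which there is $g\in L^2(X,\nu_\infty)$ with $\mathcal E(u,v)=-\int_X g v\,d\nu_\infty$ for all $v\in\mathscr{FC}_b^1(X)$, and $L_2u:=g$. It generates a strongly continuous contraction semigroup $(T_2(t))_{t\ge0}$ on $L^2(X,\nu_\infty)$. For $p\in[1,+\infty)$, $(T_p(t))_{t\ge0}$ is the unique strongly continuous positive contraction semigroup on $L^p(X,\nu_\infty)$ extending (for $p<2$) or restricting (for $p>2$) $(T_2(t))_{t\ge0}$; these satisfy $T_p(t)f=T_q(t)f$ for $f\in L^q(X,\nu_\infty)$, $q\ge p$. *)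

(* Defs.v *)
From HB Require Import structures.
From mathcomp Require Import all_boot all_order all_algebra.
From mathcomp Require Import all_classical all_reals all_analysis.

Set Implicit Arguments.
Unset Strict Implicit.
Unset Printing Implicit Defensive.

Import Order.TTheory GRing.Theory Num.Theory.
Import numFieldNormedType.Exports.

Local Open Scope classical_set_scope.
Local Open Scope ring_scope.

Notation borel X := (g_sigma_algebraType (@open X)).

Section banach.
Context {R : realType}.

Definition separable (X : topologicalType) : Prop :=
  exists2 C : set X, countable C & dense C.

(* The dual X^* is a set of plain functions; operators defined on X^* are
   total functions (X -> R) -> _, only their values on [dualspace X] being used. *)
Definition dualspace (X : normedModType R) : set (X -> R) :=
  [set f : X -> R | scalar f /\ continuous f].

Definition dual_norm (X : normedModType R) (f : X -> R) : R :=
  sup [set `|f x| | x in [set x | `|x| <= 1]].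

Record sym_nonneg_operator (X : normedModType R) (Q : (X -> R) -> X) : Prop := {
  sym_nonneg_linear : forall (a : R) f g, dualspace f -> dualspace g ->
    Q (a *: f + g) = a *: Q f + Q g ;
  sym_nonneg_bounded : exists C : R, forall f, dualspace f ->
    `|Q f| <= C * dual_norm f ;
  sym_nonneg_sym : forall f g, dualspace f -> dualspace g -> g (Q f) = f (Q g) ;
  sym_nonneg_ge0 : forall f, dualspace f -> 0 <= f (Q f) }.

End banach.

(* [V], [D] and [N] stand for the normed space D / {N = 0}: the relevant cases
   are X itself and L^p, whose elements are represented by functions; equality
   of u and v in the quotient is N (u - v) = 0. *)
Section semigroup.
Context {R : realType} {V : lmodType R} (D : set V) (N : V -> \bar R).
Local Open Scope ereal_scope.

Record contraction_semigroup (S : R -> V -> V) : Prop := {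
  semigroup_stable : forall (t : R) u, (0 <= t)%R -> D u -> D (S t u) ;
  semigroup_linear : forall (t a : R) u v, (0 <= t)%R -> D u -> D v ->
    N (S t (a *: u + v) - (a *: S t u + S t v))%R = 0 ;
  semigroup_0 : forall u, D u -> N (S 0%R u - u)%R = 0 ;
  semigroup_add : forall (s t : R) u, (0 <= s)%R -> (0 <= t)%R -> D u ->
    N (S (s + t)%R u - S s (S t u))%R = 0 ;
  semigroup_contraction : forall (t : R) u, (0 <= t)%R -> D u -> N (S t u) <= N u ;
  semigroup_strong_cont : forall u, D u ->
    N (S t u - u)%R @[t --> (0 : R)^'+] --> 0 }.

Definition generator (S : R -> V -> V) (u g : V) : Prop :=
  [/\ D u, D g & N (t^-1 *: (S t u - u) - g)%R @[t --> (0 : R)^'+] --> 0].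

End semigroup.

Definition dom {V : Type} (L : V -> V -> Prop) : set V := [set u | exists g, L u g].

Section operators.
Context {R : realType} {X : normedModType R}.

Definition banach_semigroup (S : R -> X -> X) : Prop :=
  contraction_semigroup setT (fun x => `|x|%:E) S.

Definition generates (DA : set X) (A : X -> X) (S : R -> X -> X) : Prop :=
  forall x y, (DA x /\ A x = y) <-> generator setT (fun x => `|x|%:E) S x y.

(* f belongs to D(A^* ) and A^* f = g. *)
Definition adjoint_op (DA : set X) (A : X -> X) (f g : X -> R) : Prop :=
  [/\ dualspace f, dualspace g & forall x, DA x -> f (A x) = g x].

(* Q_t x^* = \int_0^t e^{sA} Q e^{sA^*} x^* ds as a weak (Pettis) integral;
   e^{sA^*} x^* is x^* \o e^{sA}. *)
Definition is_Qt (Q : (X -> R) -> X) (S : R -> X -> X)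
    (Qt : R -> (X -> R) -> X) : Prop :=
  forall (t : R) f g, 0 < t -> dualspace f -> dualspace g ->
    g (Qt t f) = \int[lebesgue_measure]_(s in `[0, t]) g (S s (Q (f \o S s))).

End operators.

Section gaussian.
Context {R : realType} {X : normedModType R}.
Implicit Types (gamma : probability (borel X) R) (f g : X -> R).

(* The library's [normal_prob 0 0] is not the Dirac mass at 0. *)
Definition centred_normal (s : R) (A : set R) : \bar R :=
  if s == 0 then \d_(0 : R) A else normal_prob 0 s A.

Definition centred_gaussian gamma : Prop :=
  forall f, dualspace f -> exists2 s : R, 0 <= s &
    forall A : set R, measurable A -> pushforward gamma f A = centred_normal s A.

Definition nondegenerate_centred_gaussian gamma : Prop :=
  centred_gaussian gamma /\
  forall f, dualspace f -> f <> cst 0 -> exists2 s : R, 0 < s &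
    forall A : set R, measurable A -> pushforward gamma f A = centred_normal s A.

Definition is_covariance gamma (C : (X -> R) -> X) : Prop :=
  forall f g, dualspace f -> dualspace g -> g (C f) = \int[gamma]_x (f x * g x).

End gaussian.

(* H is a completion of QX^* for [Qx^*, Qy^*]_H = <Qx^*, y^*>, the class of
   Qx^* being istar x^*, and i extends continuously the inclusion of QX^* into
   X; this determines (H, i) up to a unique isometry over X. *)
Record is_rkhs {R : realType} {X : normedModType R} (Q : (X -> R) -> X)
    {H : completeNormedModType R} (ip : {dot H for idfun})
    (i : {linear H -> X}) (istar : (X -> R) -> H) : Prop := {
  rkhs_norm : forall h, ip h h = `|h| ^+ 2 ;
  rkhs_continuous : continuous i ;
  rkhs_injective : injective i ;
  rkhs_adjoint : forall f h, dualspace f -> ip (istar f) h = f (i h) ;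
  rkhs_factor : forall f, dualspace f -> i (istar f) = Q f ;
  rkhs_dense : dense [set istar f | f in @dualspace R X] }.

Section sobolev.
Context {R : realType} {X : normedModType R} {H : normedModType R}.
Variable istar : (X -> R) -> H.
Implicit Types (mu : {measure set (borel X) -> \bar R}) (p : R).

Definition C1b n (phi : 'rV[R]_n -> R) : Prop :=
  [/\ continuous phi, exists M : R, forall x, `|phi x| <= M &
   forall j : 'I_n, let e : 'rV[R]_n := delta_mx 0 j in
     [/\ forall x, derivable phi x e, continuous ('D_e phi) &
         exists M : R, forall x, `|'D_e phi x| <= M]].

(* f is in FC_b^1(X), and F is D_H f. *)
Definition cyl_gradient (f : X -> R) (F : X -> H) : Prop :=
  exists n (phi : 'rV[R]_n -> R) (xs : 'I_n -> X -> R),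
  [/\ C1b phi, forall j, dualspace (xs j),
      f = (fun x => phi (\row_j xs j x)) &
      F = (fun x => \sum_j
             'D_(delta_mx 0 j : 'rV[R]_n) phi (\row_k xs k x) *: istar (xs j))].

Definition Lp mu p : set (X -> R) :=
  [set f | (f : borel X -> R) \in Lfun mu p%:E].

Definition LpN mu p (f : X -> R) : \bar R := 'N[mu]_(p%:E)[EFin \o f].

Definition LpHN mu p (F : X -> H) : \bar R := LpN mu p (fun x => `|F x|).

Definition LpH mu p : set (X -> H) :=
  [set F | measurable_fun [set: borel X] (F : borel X -> borel H) /\
           (LpHN mu p F < +oo)%E].

(* The graph of the closure of D_H : FC_b^1(X) -> L^p(X, mu; H) in L^p(X, mu):
   u is in its domain W_H^{1,p}(X, mu) and G is D_H u. Where D_H is closable, G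
   is unique up to mu-null sets. *)
Definition DH mu p (u : X -> R) (G : X -> H) : Prop :=
  [/\ Lp mu p u, LpH mu p G &
   exists f F, [/\ forall n : nat, cyl_gradient (f n) (F n),
     LpN mu p (f n - u) @[n --> \oo] --> 0%E &
     LpHN mu p (F n - G) @[n --> \oo] --> 0%E]].

Definition W1 mu p : set (X -> R) := [set u | exists G, DH mu p u G].

Record admissible_potential mu (U : X -> \bar R) : Prop := {
  potential_gtNy : forall x, (-oo < U x)%E ;
  potential_proper : exists x, (U x < +oo)%E ;
  potential_lsc : lower_semicontinuous U ;
  potential_convex : forall (x y : X) (t : R), 0 <= t <= 1 ->
    (U (t *: x + (1 - t) *: y)%R <= t%:E * U x + (1 - t)%:E * U y)%E ;
  potential_sobolev : forall p, 1 <= p ->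
    exists2 u, W1 mu p u & U = EFin \o u %[ae mu] }.

(* nu = e^{-U} mu, with e^{-oo} = 0. *)
Definition weighted_measure mu (U : X -> \bar R) nu : Prop :=
  forall A : set (borel X), measurable A ->
    nu A = (\int[mu]_(x in A) expeR (- U x))%E.

Variables (ip : {dot H for idfun}) (B : H -> H).

(* The value of the form E at (u, v), in terms of Du = D_H u, Dv = D_H v. *)
Definition dirichlet_form nu (Du Dv : X -> H) : R :=
  - \int[nu]_(x in [set: borel X]) ip (B (Du x)) (Dv x).

Definition L2_op nu (u g : X -> R) : Prop :=
  exists2 Du, DH nu 2 u Du & Lp nu 2 g /\
    forall v Dv, cyl_gradient v Dv ->
      dirichlet_form nu Du Dv = - \int[nu]_(x in [set: borel X]) (g x * v x).

Record is_perturbed_OU nu (T : R -> R -> (X -> R) -> (X -> R)) : Prop := {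
  pOU_generator2 : forall u g,
    generator (Lp nu 2) (LpN nu 2) (T 2) u g <-> L2_op nu u g ;
  pOU_semigroup : forall p, 1 <= p ->
    contraction_semigroup (Lp nu p) (LpN nu p) (T p) ;
  pOU_positive : forall p t f, 1 <= p -> 0 <= t -> Lp nu p f ->
    {ae nu, forall x, 0 <= f x} -> {ae nu, forall x, 0 <= T p t f x} ;
  pOU_extend : forall p t f, 1 <= p < 2 -> 0 <= t -> Lp nu 2 f ->
    T p t f = T 2 t f %[ae nu] ;
  pOU_restrict : forall p t f, 2 < p -> 0 <= t -> Lp nu p f ->
    T p t f = T 2 t f %[ae nu] }.

End sobolev.

(* Main.v *)
Require Import Defs.
From HB Require Import structures.
From mathcomp Require Import all_boot all_order all_algebra.
From mathcomp Require Import all_classical all_reals all_analysis.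
From mathcomp Require Import measurable_realfun ring lra.
Set Implicit Arguments.
Unset Strict Implicit.
Unset Printing Implicit Defensive.
Import Order.TTheory GRing.Theory Num.Theory.
Import numFieldNormedType.Exports.
Local Open Scope classical_set_scope.
Local Open Scope ring_scope.

(** T_p and T_q agree on the smaller of the two spaces: for p < q < 2 because
    bounded functions are dense in L^q and both semigroups are contractive. As
    nu is finite, difference quotients converging in L^q converge in L^p, so
    D(L_q) is contained in D(L_p). For p >= 2 this reduces the embedding into
    W^{1,2}_H to p = 2, where testing the form with cylindrical approximations
    of u shows that |D_H u|^2 <= -2 [B D_H u, D_H u]_H has integral
    -2 int (L_2 u) u.

    The finiteness of nu comes from an affine minorant of the convex function U
    and the exponential moments of the Gaussian measure mu. The coercivity
    |h|^2 <= -2 [B h, h]_H comes from the invariance identity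
    Q_inf = Q_t + e^{tA} Q_inf e^{tA*}, differentiated at t = 0 on the means
    (1/s) int_0^s f o e^{rA} dr, whose images under i* are weakly, hence
    strongly, dense in H. *)

(** * The Hahn-Banach theorem and affine minorants *)

(** Three obstacles shape the proof of coercivity. The integrand of [f (Qt t f)] is only lower
    semicontinuous in time, so [Qt t] is not differentiated at 0: a lower bound near 0 is compared
    with an upper bound coming from positivity of [Qinf], and the outcome is an inequality, which is
    all that the energy estimate uses. Next, the difference quotients of [f] along the semigroup are
    needed at [Qinf f], which need not lie in the domain of A; a mean of an orbit has such a limit
    at every point, in closed form. Finally, the adjoint semigroup need not be strongly continuous,
    so the means converge to [f] only pointwise and their images in H only weakly, whereas the
    coercivity inequality passes, a priori, to norm limits only; this is why a Mazur argument is
    needed. In the spaces of integrable functions every identity between semigroups or generators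
    holds only almost everywhere. *)

Section hahn_banach.
Context {R : realType} {V : lmodType R}.
Implicit Types p q : V -> R.

(** Only an inequality is asked of positive scaling: applied to [a^-1] it gives equality, and
    [p 0 = 0] follows as well. The infima built below then need one-sided checks only. *)
Definition sublinear p :=
  (forall x y, p (x + y) <= p x + p y) /\
  (forall a x, 0 < a -> p (a *: x) <= a * p x).

Lemma sublinear0 p : sublinear p -> p 0 = 0.
Proof.
move=> [_ pZ]; have := pZ 2 0; have := pZ 2^-1 0.
by rewrite !scaler0 invr_gt0 ltr0n => /(_ isT) + /(_ isT); lra.
Qed.

Lemma sublinear_scale p a x : sublinear p -> 0 < a -> p (a *: x) = a * p x.
Proof.
move=> [_ pZ] a0; apply/eqP; rewrite eq_le pZ//=.
have := pZ a^-1 (a *: x); rewrite invr_gt0 => /(_ a0).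
rewrite scalerA mulVf ?gt_eqF// scale1r.
by rewrite ler_pdivlMl.
Qed.

Lemma sublinear_opp p x : sublinear p -> - p (- x) <= p x.
Proof.
move=> sp; rewrite lerNl -subr_ge0 opprK.
by rewrite -(sublinear0 sp) -[X in p X <= _](addNr x); case: sp.
Qed.

Let below p : Type := {q : V -> R | sublinear q /\ forall x, q x <= p x}.

(** The pointwise infimum works: [- p (- x)] bounds the chain below at [x], and totality lets the
    smaller of two members serve both terms in subadditivity. The empty chain is bounded by [p]
    itself. *)
Let chain_inf p (A : set (below p)) : sublinear p ->
  total_on A (fun q r : below p => forall x, sval r x <= sval q x) ->
  exists t : below p, forall s : below p, A s -> forall x, sval t x <= sval s x.
Proof.
move=> sp tA.
have [[s0 As0]|A0] := pselect (exists s, A s); last first.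
  have pp : sublinear p /\ forall x, p x <= p x by [].
  by exists (exist _ p pp) => s As; exfalso; apply: A0; exists s.
pose E x := [set sval s x | s in A].
have E0 x : E x !=set0 by exists (sval s0 x), s0.
have lbE x : has_lbound (E x).
  exists (- p (- x)) => _ [s As <-]; case: (svalP s) => ss sle.
  by apply: le_trans (sublinear_opp _ ss); rewrite lerN2.
have infE x s : A s -> inf (E x) <= sval s x.
  by move=> As; apply: ge_inf => //; exists s.
have sq : sublinear (fun x => inf (E x)).
  split=> [x y|a x a0].
    rewrite -lerBlDr; apply: lb_le_inf => // _ [s As <-].
    rewrite lerBlDl -lerBlDr; apply: lb_le_inf => // _ [t At <-].
    rewrite lerBlDr; have [st|ts] := tA _ _ As At.
      apply: le_trans (infE _ _ At) _; case: (svalP t) => -[+ _] _.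
      by move=> /(_ x y)/le_trans; apply; rewrite addrC lerD2l.
    apply: le_trans (infE _ _ As) _; case: (svalP s) => -[+ _] _.
    by move=> /(_ x y)/le_trans; apply; rewrite addrC lerD2r.
  rewrite -ler_pdivrMl//; apply: lb_le_inf => // _ [s As <-].
  rewrite ler_pdivrMl//; apply: le_trans (infE _ _ As) _.
  by case: (svalP s) => -[_ +] _; exact.
have qp : forall x, inf (E x) <= p x.
  by move=> x; apply: le_trans (infE x s0 As0) _; case: (svalP s0).
by exists (exist _ (fun x => inf (E x)) (conj sq qp) : below p) => s As x /=; exact: infE.
Qed.

(* A minimal sublinear functional q is linear: it is bounded below by the
   sublinear functional inf_{t >= 0} (q (x + t y) - t q y). *)
Lemma hahn_banach p : sublinear p ->
  exists2 l : V -> R, scalar l & forall x, l x <= p x.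
Proof.
move=> sp.
(* The order is reversed, so the maximal element that Zorn provides is a minimal sublinear
   functional. *)
have [|||A tA|q minq] := @Zorn (below p)
    (fun q r : below p => `[< forall x, sval r x <= sval q x >]).
- by move=> t; apply/asboolP.
- by move=> r s t /asboolP rs /asboolP st; apply/asboolP => x; exact: le_trans (rs x).
- move=> [s ss] [t tt] /asboolP /= st /asboolP /= ts; apply: eq_exist.
  by apply/funext => x; apply: le_anti; rewrite st ts.
- have [|t tlb] := chain_inf sp (A := A).
    by move=> s t As At; have [] := tA _ _ As At => /asboolP; [left|right].
  by exists t => s As; apply/asboolP => x; exact: tlb.
case: q minq => q [sq qp] /= minq.
have qsup x y : q x + q y <= q (x + y).
  pose E z := [set q (z + t *: y) - t * q y | t in [set t : R | 0 <= t]].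
  have E0 z : E z !=set0.
    by exists (q (z + 0 *: y) - 0 * q y); exists 0 => //=; exact: lexx.
  have lbE z : has_lbound (E z).
    exists (- q (- z)) => _ [t /= t0 <-].
    have -> : t * q y = q (t *: y).
      move: t0; rewrite le_eqVlt => /predU1P[<-|t0].
        by rewrite scale0r (sublinear0 sq) mul0r.
      by rewrite (sublinear_scale _ sq).
    rewrite lerNl opprB lerBlDr.
    rewrite -{1}[t *: y](addKr z).
    by have [] := sq.
  have infE z t : 0 <= t -> inf (E z) <= q (z + t *: y) - t * q y.
    by move=> t0; apply: ge_inf => //; exists t.
  have sr : sublinear (fun z => inf (E z)).
    split=> [z w|a z a0].
      rewrite -lerBlDr; apply: lb_le_inf => // _ [s /= s0 <-].
      rewrite lerBlDl -lerBlDr; apply: lb_le_inf => // _ [t /= t0 <-].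
      rewrite lerBlDr; apply: le_trans (infE _ (s + t) (addr_ge0 s0 t0)) _.
      have [+ _] := sq => /(_ (z + s *: y) (w + t *: y)).
      rewrite addrACA -scalerDl; lra.
    rewrite -ler_pdivrMl//; apply: lb_le_inf => // _ [s /= s0 <-].
    rewrite ler_pdivrMl//; apply: le_trans (infE _ (a * s) _) _.
      by rewrite mulr_ge0// ltW.
    by rewrite -scalerA -scalerDr (sublinear_scale _ sq)// mulrBr mulrA.
  have rq z : inf (E z) <= q z.
    by have := infE z 0 (lexx _); rewrite scale0r addr0 mul0r subr0.
  have rp z : inf (E z) <= p z by exact: le_trans (rq z) (qp z).
  (* Minimality identifies the infimum with [q]; its bound at [t = 1] then reads
     [q x <= q (x + y) - q y]. *)
  have /(_ _)/(congr1 sval)/= := minq (exist _ (fun z => inf (E z)) (conj sr rp)).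
  move=> /(_ _)/(congr1 (fun f => f x)) <-; last by apply/asboolP.
  have := infE x 1 ler01; rewrite scale1r mul1r; lra.
have qD x y : q (x + y) = q x + q y.
  by apply/eqP; rewrite eq_le qsup andbT; have [] := sq.
have qNE x : q (- x) = - q x.
  by have := qD x (- x); rewrite subrr (sublinear0 sq); lra.
exists q => // a x y; rewrite qD; congr (_ + _).
have [a0|a0|->] := ltgtP a 0.
- rewrite -[a]opprK scaleNr qNE (sublinear_scale _ sq) ?oppr_gt0//.
  by rewrite !mulNr.
- exact: sublinear_scale.
by rewrite scale0r (sublinear0 sq) mul0r.
Qed.

End hahn_banach.

Section dual.
Context {R : realType} {X : normedModType R}.
Implicit Types f g : X -> R.

Lemma scalar_add f : scalar f -> forall x y, f (x + y) = f x + f y.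
Proof. by move=> lf x y; have := lf 1 x y; rewrite scale1r mul1r. Qed.

Lemma scalar_at0 f : scalar f -> f 0 = 0.
Proof. by move=> lf; have := scalar_add lf 0 0; rewrite addr0; lra. Qed.

Lemma scalar_scale f : scalar f -> forall a x, f (a *: x) = a * f x.
Proof. by move=> lf a x; have := lf a x 0; rewrite !addr0 (scalar_at0 lf) addr0. Qed.

Lemma scalar_opp f : scalar f -> forall x, f (- x) = - f x.
Proof. by move=> lf x; rewrite -scaleN1r (scalar_scale lf) mulN1r. Qed.

Lemma scalar_sub f : scalar f -> forall x y, f (x - y) = f x - f y.
Proof. by move=> lf x y; rewrite (scalar_add lf) (scalar_opp lf). Qed.

Lemma bounded_dualspace f (K : R) : scalar f -> (forall x, `|f x| <= K * `|x|) ->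
  dualspace f.
Proof.
move=> lf fK; split=> // x; apply/cvgrPdist_lt => e e0.
have K0 : 0 < `|K| + 1 by rewrite ltr_wpDl.
have d0 : 0 < e / (`|K| + 1) by rewrite divr_gt0.
near=> y; rewrite -(scalar_sub lf); apply: le_lt_trans (fK _) _.
have : `|x - y| < e / (`|K| + 1).
  by near: y; exact: (cvgrPdist_lt _ _).1 cvg_id _ d0.
rewrite ltr_pdivlMr// => /(le_lt_trans _); apply.
rewrite mulrC ler_wpM2l// (le_trans (ler_norm K))// lerDl//.
Unshelve. all: by end_near. Qed.

Lemma dualspace_bounded f : dualspace f ->
  exists2 K : R, 0 <= K & forall x, `|f x| <= K * `|x|.
Proof.
move=> [lf cf].
have : f x @[x --> (0 : X)] --> (0 : R).
  by rewrite -[X in _ --> X](scalar_at0 lf); exact: cf.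
move=> /cvgrPdist_lt /(_ 1 ltr01) /nbhs_ballP[d /= d0 dP].
exists (2 / d); first by rewrite divr_ge0 ?ltW.
move=> x; have [->|x0] := eqVneq x 0.
  by rewrite (scalar_at0 lf) !normr0 mulr0.
have nx : 0 < `|x| by rewrite normr_gt0.
have := dP ((d / 2 / `|x|) *: x); rewrite /= -ball_normE /= sub0r normrN normrZ.
have c0 : 0 < d / 2 / `|x| by rewrite !divr_gt0.
rewrite (gtr0_norm c0) divfK ?gt_eqF//.
have -> : d / 2 < d by lra.
move=> /(_ isT); rewrite sub0r normrN (scalar_scale lf) normrM (gtr0_norm c0).
move=> /ltW; rewrite -ler_pdivlMl// mulr1 !invf_div.
by rewrite mulrC mulrAC -mulrA mulrC.
Qed.

Lemma dualspace_comb f g (a : R) : dualspace f -> dualspace g ->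
  dualspace (a *: f + g).
Proof.
move=> df dg; have [[lf _] [lg _]] := (df, dg).
have [K K0 fK] := dualspace_bounded df; have [L L0 gL] := dualspace_bounded dg.
apply: (@bounded_dualspace _ (`|a| * K + L)) => [b x y|x].
  change (a * f (b *: x + y) + g (b *: x + y) =
    b * (a * f x + g x) + (a * f y + g y)).
  by rewrite lf lg /=; ring.
change (`|a * f x + g x| <= (`|a| * K + L) * `|x|).
rewrite (le_trans (ler_normD _ _))// mulrDl lerD// normrM -mulrA.
by rewrite ler_wpM2l.
Qed.

End dual.

Section affine_minorant.
Context {R : realType} {X : normedModType R}.
Variable U : X -> \bar R.
Hypotheses (UgtNy : forall x, (-oo < U x)%E)
  (U_proper : exists x, (U x < +oo)%E) (U_lsc : lower_semicontinuous U)
  (U_convex : forall (x y : X) (t : R), 0 <= t <= 1 ->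
    (U (t *: x + (1 - t) *: y)%R <= t%:E * U x + (1 - t)%:E * U y)%E).

Let U_fin x : (U x < +oo)%E -> U x = (fine (U x))%:E.
Proof.
by move=> Ux; rewrite fineK// fin_numElt UgtNy Ux.
Qed.

Let fine_convex x y t : 0 <= t <= 1 -> (U x < +oo)%E -> (U y < +oo)%E ->
  (U (t *: x + (1 - t) *: y)%R < +oo)%E /\
  fine (U (t *: x + (1 - t) *: y)) <= t * fine (U x) + (1 - t) * fine (U y).
Proof.
move=> t01 Ux Uy; have := U_convex x y t01; rewrite (U_fin Ux) (U_fin Uy).
rewrite -!EFinM -EFinD => le; have lt := le_lt_trans le (ltry _); split=> //.
by move: le; rewrite (U_fin lt) lee_fin.
Qed.

(** Lower semicontinuity gives [U > U x0 - 1] on a ball of radius [r] around [x0]. For [x] outside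
    it, the point of the segment from [x0] to [x] at distance [r / 2] from [x0] is still in the
    ball, and convexity extrapolates the bound to [x] with slope [2 / r]. *)
Let conic_minorant x0 : (U x0 < +oo)%E -> exists2 K : R, 0 <= K &
  forall x, (U x < +oo)%E -> fine (U x0) - 1 - K * `|x - x0| <= fine (U x).
Proof.
move=> Ux0; have := U_lsc (x := x0) (a := fine (U x0) - 1).
rewrite {2}(U_fin Ux0) lte_fin => /(_ _)[|V]; first by rewrite ltrBlDr ltrDl.
move=> /nbhs_ballP[r /= r0 rV] VU.
exists (2 / r); first by rewrite divr_ge0 ?ltW.
move=> x Ux; have [xr|xr] := ltP `|x - x0| r.
  have /VU : V x by apply: rV; rewrite -ball_normE /= distrC.
  rewrite (U_fin Ux) lte_fin => /ltW; apply: le_trans.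
  by rewrite gerBl mulr_ge0// divr_ge0// ltW.
have d0 : 0 < `|x - x0| by exact: lt_le_trans xr.
pose t := r / 2 / `|x - x0|.
have t0 : 0 < t by rewrite !divr_gt0.
have t1 : t <= 1 by rewrite ler_pdivrMr// mul1r; lra.
have t01 : 0 <= t <= 1 by rewrite (ltW t0).
have [Uy] := fine_convex t01 Ux Ux0.
have /VU : V (t *: x + (1 - t) *: x0).
  apply: rV; rewrite -ball_normE /= distrC.
  have -> : t *: x + (1 - t) *: x0 - x0 = t *: (x - x0).
    by rewrite scalerBl scale1r scalerBr addrA addrAC addrK.
  rewrite normrZ gtr0_norm// /t divfK ?gt_eqF//; lra.
rewrite (U_fin Uy) lte_fin => h1 h2.
have h3 : - 1 < t * (fine (U x) - fine (U x0)) by move: h1 h2; lra.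
have -> : 2 / r * `|x - x0| = t^-1 by rewrite /t !invf_div mulrC.
have h4 : - t^-1 < fine (U x) - fine (U x0).
  by move: h3; rewrite -ltr_pdivrMl// mulrN1.
lra.
Qed.

(** The Hahn-Banach theorem is applied to the infimal convolution of [K |.|] with the positively
    homogeneous hull of a translate of [U]. The cone makes the linear functional continuous, the
    hull keeps it below [U]. *)
Lemma affine_minorant : exists (l : X -> R) (c : R), dualspace l /\
  forall x, ((l x + c)%:E <= U x)%E.
Proof.
have [x0 Ux0] := U_proper; have [K K0 UK] := conic_minorant Ux0.
pose D := [set y | (U (x0 + y)%R < +oo)%E].
(* The summand 1 makes up for the loss of 1 in the conic minorant, so that [G] lies above a cone
   with vertex value 0. *)
pose G y := fine (U (x0 + y)) - fine (U x0) + 1.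
have D0 : D 0 by rewrite /D /= addr0.
have G0 : G 0 = 1 by rewrite /G addr0 subrr add0r.
have GK y : D y -> - (K * `|y|) <= G y.
  move=> Dy; have := UK _ Dy.
  have -> : x0 + y - x0 = y by rewrite addrC addKr.
  by rewrite /G; lra.
(* Convexity in homogeneous form, with weights [s / (s + t)] and [t / (s + t)]; it yields
   subadditivity of the infimum below. *)
have Gc y z s t : D y -> D z -> 0 < s -> 0 < t ->
    exists2 w, D w & (s + t) *: w = s *: y + t *: z /\
      (s + t) * G w <= s * G y + t * G z.
  move=> Dy Dz s0 t0; have st0 : 0 < s + t by exact: addr_gt0.
  pose a := s / (s + t).
  have a01 : 0 <= a <= 1.
    rewrite /a ler_pdivrMr// mul1r lerDl (ltW t0) andbT.
    by rewrite divr_ge0 // ltW.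
  have sa : (s + t) * a = s by rewrite mulrC /a divfK ?gt_eqF.
  have ta : (s + t) * (1 - a) = t by rewrite mulrBr sa mulr1; lra.
  clearbody a.
  have E : a *: (x0 + y) + (1 - a) *: (x0 + z) = x0 + (a *: y + (1 - a) *: z).
    by rewrite !scalerDr addrACA -scalerDl subrKC scale1r.
  have := fine_convex a01 Dy Dz; rewrite E => -[Dw Gw].
  exists (a *: y + (1 - a) *: z) => //; split.
    by rewrite scalerDr !scalerA sa ta.
  have := ler_wpM2l (ltW st0) Gw; rewrite mulrDr !mulrA sa ta /G; lra.
pose E x := [set z | exists t y, [/\ 0 < t, D y & z = t * G y + K * `|x - t *: y|]].
have E0 x : E x !=set0.
  by exists (1 * G 0 + K * `|x - 1 *: 0|), 1, 0.
have lbE x : has_lbound (E x).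
  exists (- (K * `|x|)) => _ [t [y [t0 Dy ->]]].
  have := ler_wpM2l (ltW t0) (GK _ Dy).
  have : K * `|x| >= K * (`|t *: y| - `|x - t *: y|).
    by apply: ler_wpM2l => //; rewrite lerBlDr -[X in `|X| <= _](subrK x) addrC
      (le_trans (ler_normD _ _))// distrC.
  have : K * `|t *: y| <= K * `|x| + K * `|x - t *: y|.
    by rewrite -mulrDr ler_wpM2l// -[X in `|X| <= _](subrK x) addrC
      (le_trans (ler_normD _ _))// distrC.
  rewrite normrZ gtr0_norm// mulrN; rewrite mulrCA; lra.
have infE x t y : 0 < t -> D y -> inf (E x) <= t * G y + K * `|x - t *: y|.
  by move=> t0 Dy; apply: ge_inf => //; exists t, y.
have sE : sublinear (fun x => inf (E x)).
  split=> [x1 x2|a x a0].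
    rewrite -lerBlDr; apply: lb_le_inf => // _ [s [y [s0 Dy ->]]].
    rewrite lerBlDl -lerBlDr; apply: lb_le_inf => // _ [t [z [t0 Dz ->]]].
    have [w Dw [wE wG]] := Gc y z s t Dy Dz s0 t0.
    have := infE (x1 + x2) (s + t) w (addr_gt0 s0 t0) Dw.
    have : K * `|x1 + x2 - (s + t) *: w| <=
        K * `|x1 - s *: y| + K * `|x2 - t *: z|.
      by rewrite -mulrDr ler_wpM2l// wE opprD addrACA ler_normD.
    move: wG; lra.
  rewrite -ler_pdivrMl//; apply: lb_le_inf => // _ [t [y [t0 Dy ->]]].
  rewrite ler_pdivrMl//; apply: le_trans (infE _ (a * t) _ _ Dy) _.
    exact: mulr_gt0.
  by rewrite -scalerA -scalerBr normrZ gtr0_norm//; lra.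
have [l ll lE] := hahn_banach sE.
(* The choice [y = 0], [t = e] costs only [e * G 0 = e]. The other choice, [t = 1] and [y = x - x0],
   gives the minorant at the end. *)
have lK x : l x <= K * `|x|.
  apply/ler_addgt0Pr => e e0; apply: le_trans (lE x) _.
  by have := infE x e 0 e0 D0; rewrite G0 scaler0 subr0 mulr1 addrC.
have dl : dualspace l.
  apply: (@bounded_dualspace _ _ _ K) => // x.
  by rewrite ler_norml lK andbT lerNl -(scalar_opp ll) -(normrN x).
exists l, (fine (U x0) - 1 - l x0); split=> // x.
have [Ux|] := ltP (U x) +oo%E; last by move=> h; apply: le_trans h; exact: leey.
rewrite (U_fin Ux) lee_fin.
have Dx : D (x - x0) by rewrite /D /= subrKC.
have := le_trans (lE _) (infE (x - x0) 1 _ ltr01 Dx).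
by rewrite scale1r subrr normr0 mulr0 addr0 mul1r (scalar_sub ll) /G subrKC; lra.
Qed.

End affine_minorant.

(** * Finiteness of the weighted measure *)

Section borel_measurability.
Context {R : realType} {X : normedModType R}.

Lemma open_borel_measurable (A : set X) : open A -> measurable (A : set (borel X)).
Proof. by move=> oA; exact: sub_sigma_algebra. Qed.

Lemma continuous_borel_measurable (f : X -> R) : continuous f ->
  measurable_fun [set: borel X] (f : borel X -> R).
Proof.
move=> /continuousP cf; apply: (measurability _ (RGenOpens.measurableE R)).
move=> _ [_ [a [b ->] <-]]; rewrite setTI; apply: open_borel_measurable.
exact/cf/interval_open.
Qed.

Lemma measurable_expeRN_lsc (U : X -> \bar R) : lower_semicontinuous U ->
  measurable_fun [set: borel X] ((fun x => expeR (- U x)) : borel X -> \bar R).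
Proof.
move=> /lower_semicontinuousP oU.
apply: (measurability _ (ErealGenInftyO.measurableE R)).
move=> _ [_ [a ->] <-]; rewrite setTI; apply: open_borel_measurable.
have [a0|a0] := leP a 0.
  rewrite (_ : _ @^-1` _ = set0); first exact: open0.
  rewrite -subset0 => x /=; rewrite in_itv /= => /lt_le_trans h.
  have := h 0%E; rewrite lee_fin => /(_ a0).
  by rewrite ltNge expeR_ge0.
have eE : expeR (ln a)%:E = a%:E by rewrite /= lnK.
rewrite (_ : _ @^-1` _ = [set x | ((- ln a)%:E < U x)%E]) //.
apply/seteqP; split=> x /=; rewrite in_itv /=.
  by rewrite -eE lte_expeR lteNl.
by move=> h; rewrite -eE lte_expeR lteNl.
Qed.

End borel_measurability.

Section gaussian_exponential_moment.
Context {R : realType}.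
Local Notation mu := (@lebesgue_measure R).

(** The Radon-Nikodym derivative and the density have the same integral over every measurable set,
    hence agree almost everywhere. *)
Lemma integral_normal_prob_density (s : R) (f : R -> \bar R) :
  measurable_fun setT f -> (forall x, 0 <= f x)%E ->
  (\int[normal_prob 0%R s]_x f x =
   \int[mu]_x (f x * (normal_pdf 0 s x)%:E))%E.
Proof.
move=> mf f0; have dom := normal_prob_dominates (0 : R) s.
rewrite -(Radon_Nikodym_SigmaFinite.change_of_variables dom)//.
apply: ae_eq_integral => //.
- apply: emeasurable_funM => //; apply: measurable_int.
  exact: Radon_Nikodym_SigmaFinite.f_integrable.
- apply: emeasurable_funM => //; apply/measurable_EFinP.
  exact: measurable_normal_pdf.
apply: ae_eqe_mul2l; apply: integral_ae_eq => //.
- exact: Radon_Nikodym_SigmaFinite.f_integrable.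
- by apply/measurable_EFinP; exact: measurable_normal_pdf.
by move=> E _ mE; rewrite -Radon_Nikodym_SigmaFinite.f_integral.
Qed.

(* [e^{-x}] times the density of N(0, s^2) is, up to the factor
   [e^{s^2 / 2}], the density of N(-s^2, s^2). *)
Lemma normal_exponential_moment (s : R) : s != 0 ->
  (\int[normal_prob 0%R s]_x (expR (- x))%:E < +oo)%E.
Proof.
move=> s0; rewrite integral_normal_prob_density//; last first.
- by apply/measurable_EFinP; apply: measurableT_comp => //; exact: oppr_measurable.
have E x : ((expR (- x))%:E * (normal_pdf 0 s x)%:E =
    (expR (s ^+ 2 / 2))%:E * (normal_pdf (- s ^+ 2) s x)%:E)%E.
  rewrite !normal_pdfE// -!EFinM; congr EFin.
  rewrite mulrCA [RHS]mulrCA; congr (_ * _); rewrite /normal_fun -!expRD.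
  congr expR; rewrite subr0 opprK -[_ *+ 2]mulr_natr.
  have : s ^+ 2 != 0 by rewrite sqrf_eq0.
  by move: (s ^+ 2) => a a0; field.
under eq_integral do rewrite E.
rewrite integralZl//; last exact: integrable_normal_pdf.
by rewrite integral_normal_pdf mule1 ltry.
Qed.

Lemma centred_normal_exponential_moment (m : {measure set (measurableTypeR R) -> \bar R})
    (s : R) :
  (forall A, measurable A -> m A = centred_normal s A) ->
  (\int[m]_x (expR (- x))%:E < +oo)%E.
Proof.
move=> mE; have [s0|s0] := eqVneq s 0.
  rewrite (eq_measure_integral (\d_(0 : measurableTypeR R))) => [|A mA _]; last first.
    by rewrite mE// /centred_normal s0 eqxx.
  rewrite integral_dirac ?diracT ?mul1e ?ltry//.
  by apply/measurable_EFinP; apply: measurableT_comp => //; exact: oppr_measurable.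
have -> : (\int[m]_x (expR (- x))%:E = \int[normal_prob 0%R s]_x (expR (- x))%:E)%E.
  by apply: eq_measure_integral => A mA _; rewrite mE// /centred_normal (negbTE s0).
exact: normal_exponential_moment.
Qed.

End gaussian_exponential_moment.

Section weighted_measure_finite.
Context {R : realType} {X H : normedModType R}.
Variables (mu : probability (borel X) R) (istar : (X -> R) -> H)
  (U : X -> \bar R) (nu : {measure set (borel X) -> \bar R}).

Lemma weighted_gaussian_finite : centred_gaussian mu ->
  admissible_potential istar mu U -> weighted_measure mu U nu ->
  (nu setT < +oo)%E.
Proof.
move=> gmu aU ->//.
have [l [c [dl lU]]] := affine_minorant (potential_gtNy aU) (potential_proper aU)
  (potential_lsc aU) (potential_convex aU).
have [s s0 sE] := gmu _ dl.
have ml : measurable_fun [set: borel X] (l : borel X -> R).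
  by apply: continuous_borel_measurable; case: dl.
have mexp : measurable_fun setT (fun x : R => (expR (- x))%:E).
  by apply/measurable_EFinP; apply: measurableT_comp => //; exact: oppr_measurable.
have ml' : measurable_fun [set: borel X] (l : borel X -> measurableTypeR R).
  exact: ml.
pose m : {measure set (measurableTypeR R) -> \bar R} :=
  pushforward mu (l : borel X -> measurableTypeR R).
have lfin : (\int[mu]_x (expR (- l x))%:E < +oo)%E.
  have := @centred_normal_exponential_moment _ (m ml') s sE.
  congr (_ < _)%E.
  exact: (@ge0_integral_pushforward _ _ _ _ _ _ ml' mu setT
    (fun x : R => (expR (- x))%:E) measurableT mexp (fun x _ => expR_ge0 _)).
apply: (@le_lt_trans _ _ (\int[mu]_x ((expR (- c))%:E * (expR (- l x))%:E))%E).
  apply: ge0_le_integral => //.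
  - by move=> x _; exact: expeR_ge0.
  - by apply: measurable_expeRN_lsc; exact: potential_lsc aU.
  - apply: emeasurable_funM => //.
    exact: (measurableT_comp mexp ml).
  move=> x _; rewrite -EFinM -expRD -opprD addrC.
  have -> : (expR (- (l x + c)))%:E = expeR (- (l x + c)%:E) by [].
  by rewrite lee_expeR leeN2.
rewrite ge0_integralZl//; last exact: (measurableT_comp mexp ml).
by rewrite lte_mul_pinfty// lee_fin expR_ge0.
Qed.

End weighted_measure_finite.

(** * Coercivity of B *)

Section itv_integral.
Context {R : realType}.
Local Notation mu := (@lebesgue_measure R).

Definition int_upto (F : R -> R) (t : R) : R := \int[mu]_(r in `[0, t]) F r.

Lemma bounded_integrable_itv (F : R -> R) (M a b : R) :
  measurable_fun setT F -> (forall r, `|F r| <= M) ->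
  mu.-integrable `[a, b] (EFin \o F).
Proof.
move=> mF FM; apply: measurable_bounded_integrable => //.
- by rewrite /= lebesgue_measure_itv /=; case: ifP => // _; rewrite -EFinB ltry.
- exact: measurable_funTS.
by exists M; split; [exact: num_real|move=> x Mx r _ /=; rewrite (le_trans (FM r))// ltW].
Qed.

Lemma measurable_shift (t : R) :
  measurable_fun setT ((fun r => r + t) : measurableTypeR R -> measurableTypeR R).
Proof. exact: measurable_funD. Qed.

Lemma lebesgue_measure_shift (t : R) (A : set R) : measurable A ->
  pushforward mu ((fun r => r + t) : measurableTypeR R -> measurableTypeR R) A =
  mu A.
Proof.
pose m : {measure set (measurableTypeR R) -> \bar R} :=
  pushforward mu ((fun r => r + t) : measurableTypeR R -> measurableTypeR R).
move=> mA; apply/esym.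
apply: (@lebesgue_measure_unique _ (m (measurable_shift t)) _ A mA) => /= _ [[a b]] _ <-.
rewrite /m /= /pushforward.
rewrite (_ : _ @^-1` _ = `]a - t, b - t]%classic); last first.
  by apply/seteqP; split=> r /=; rewrite !in_itv /= ltrBlDr lerBrDr.
rewrite !lebesgue_measure_itv /= !lte_fin ltrD2r.
by case: ifP => // _; rewrite -!EFinB; congr EFin; ring.
Qed.

Lemma Rintegral_shift (F : R -> R) (M a b t : R) :
  measurable_fun setT F -> (forall r, `|F r| <= M) ->
  \int[mu]_(r in `[a, b]) F (r + t) = \int[mu]_(r in `[a + t, b + t]) F r.
Proof.
move=> mF FM; rewrite /Rintegral; congr fine.
have mt := @measurable_shift t.
have E : (fun r => r + t) @^-1` `[a + t, b + t]%classic = `[a, b]%classic.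
  by apply/seteqP; split=> r /=; rewrite !in_itv /= !lerD2r.
have mFE : measurable_fun setT (EFin \o F) by exact/measurable_EFinP.
have iF : mu.-integrable ((fun r => r + t) @^-1` `[a + t, b + t]%classic)
    ((EFin \o F) \o (fun r => r + t)).
  rewrite E; apply: (bounded_integrable_itv (M := M)) => //.
  exact: (measurableT_comp mF).
have := @integral_pushforward _ _ _ _ R _ mt mu _ _ mFE iF (measurable_itv _).
rewrite E => <-.
by apply: eq_measure_integral => A mA _; exact: lebesgue_measure_shift.
Qed.

Lemma int_upto_add (F : R -> R) (M s t : R) : 0 <= s -> 0 <= t ->
  measurable_fun setT F -> (forall r, `|F r| <= M) ->
  int_upto F (t + s) = int_upto F t + int_upto (fun r => F (t + r)) s.
Proof.
move=> s0 t0 mF FM; rewrite /int_upto.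
have := @Rintegral_itvB _ F (BLeft 0) (BRight (t + s)) t
  (bounded_integrable_itv _ _ mF FM).
rewrite !bnd_simp lerDl => /(_ t0 s0) h.
apply/eqP; rewrite [X in _ == X]addrC -subr_eq; apply/eqP; rewrite h.
rewrite Rintegral_itv_obnd_cbnd; last first.
  apply: integrableS (bounded_integrable_itv t (t + s) mF FM) => //.
  by apply: subset_itvr; rewrite bnd_simp.
have := Rintegral_shift 0 s t mF FM; rewrite add0r (addrC s) => <-.
by apply: eq_Rintegral => r _; rewrite addrC.
Qed.

Lemma int_upto_ge (F : R -> R) (M t c : R) : 0 <= t ->
  measurable_fun setT F -> (forall r, `|F r| <= M) ->
  (forall r, 0 <= r <= t -> c <= F r) -> c * t <= int_upto F t.
Proof.
move=> t0 mF FM cF.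
have -> : c * t = \int[mu]_(r in `[0, t]) (cst c r).
  rewrite Rintegral_cst// /= lebesgue_measure_itv /= lte_fin.
  by move: t0; rewrite le_eqVlt => /predU1P[<-|->]; rewrite ?ltxx //= oppr0 addr0.
apply: le_Rintegral => //.
- apply: (bounded_integrable_itv (M := `|c|)) => //.
- exact: (bounded_integrable_itv _ _ mF FM).
Qed.

Lemma int_upto_linear (F G : R -> R) (M a t : R) :
  measurable_fun setT F -> (forall r, `|F r| <= M) ->
  measurable_fun setT G -> (forall r, `|G r| <= M) ->
  int_upto (fun r => a * F r + G r) t = a * int_upto F t + int_upto G t.
Proof.
move=> mF FM mG GM; rewrite /int_upto RintegralD ?RintegralZl//.
- exact: (bounded_integrable_itv _ _ mF FM).
- apply: (bounded_integrable_itv (M := `|a| * M)).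
    exact: measurable_funM.
  by move=> r; rewrite normrM ler_wpM2l.
- exact: (bounded_integrable_itv _ _ mG GM).
Qed.

Lemma eq_int_upto (F G : R -> R) (t : R) :
  (forall r, 0 <= r -> F r = G r) -> int_upto F t = int_upto G t.
Proof.
move=> FG; apply: eq_Rintegral => r; rewrite inE /= in_itv /= => /andP[r0 _].
exact: FG.
Qed.

Lemma int_uptoN (F : R -> R) (M t : R) :
  measurable_fun setT F -> (forall r, `|F r| <= M) ->
  int_upto (fun r => - F r) t = - int_upto F t.
Proof.
move=> mF FM.
(* Writing [- F] as [-2 F + F] puts it in the form covered by [int_upto_linear]. *)
have -> : int_upto (fun r => - F r) t = int_upto (fun r => (-2) * F r + F r) t.
  by apply: eq_int_upto => r _; ring.
by rewrite (int_upto_linear (-2) t mF FM mF FM); ring.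
Qed.

Lemma int_upto_le (F : R -> R) (M t c : R) : 0 <= t ->
  measurable_fun setT F -> (forall r, `|F r| <= M) ->
  (forall r, 0 <= r <= t -> F r <= c) -> int_upto F t <= c * t.
Proof.
move=> t0 mF FM Fc; rewrite -lerN2 -(int_uptoN t mF FM) -mulNr.
apply: (int_upto_ge t0 (M := M)) => [|r|r rt].
- exact: measurableT_comp.
- by rewrite normrN.
- by rewrite lerN2; exact: Fc.
Qed.

Lemma int_upto_norm_le (F : R -> R) (M t c : R) : 0 <= t ->
  measurable_fun setT F -> (forall r, `|F r| <= M) ->
  (forall r, 0 <= r <= t -> `|F r| <= c) -> `|int_upto F t| <= c * t.
Proof.
move=> t0 mF FM cF; rewrite ler_norml -mulNr; apply/andP; split.
  by apply: (int_upto_ge t0 mF FM) => r /cF; rewrite ler_norml => /andP[].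
by apply: (int_upto_le t0 mF FM) => r /cF; rewrite ler_norml => /andP[].
Qed.

End itv_integral.

Section linear_bound.
Context {R : realType} {V W : normedModType R}.

Lemma continuous_linear_norm_bound (f : {linear V -> W}) : continuous f ->
  exists2 K : R, 0 <= K & forall x, `|f x| <= K * `|x|.
Proof.
move=> /linear_bounded_continuous/linear_boundedP fK.
have [K [K0 KP]] : exists K : R, 0 <= K /\ forall x, `|f x| <= K * `|x|.
  apply: (@filter_ex _ (+oo_R)); near=> r; split.
    by near: r; apply: nbhs_pinfty_ge; exact: num_real.
  by near: r.
by exists K.
Unshelve. all: by end_near. Qed.

End linear_bound.

(** * Hilbert space geometry *)

Section inner_product.
Context {R : realType} {H : normedModType R} (ip : {dot H for idfun}).
Hypothesis ip_norm : forall h, ip h h = `|h| ^+ 2.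

Lemma ipC u v : ip u v = ip v u.
Proof. by rewrite hermC expr0 mul1r. Qed.

Lemma ipDl u v w : ip (u + v) w = ip u w + ip v w.
Proof. exact: linearDl. Qed.

Lemma ipZl a u w : ip (a *: u) w = a * ip u w.
Proof. by rewrite linearZl_LR. Qed.

Lemma ipNl u w : ip (- u) w = - ip u w.
Proof. by rewrite -scaleN1r ipZl mulN1r. Qed.

Lemma ipBl u v w : ip (u - v) w = ip u w - ip v w.
Proof. by rewrite ipDl ipNl. Qed.

Lemma ipDr u v w : ip u (v + w) = ip u v + ip u w.
Proof. by rewrite ipC ipDl !(ipC u). Qed.

Lemma ipZr a u w : ip u (a *: w) = a * ip u w.
Proof. by rewrite ipC ipZl ipC. Qed.

Lemma ipBr u v w : ip u (v - w) = ip u v - ip u w.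
Proof. by rewrite ipC ipBl !(ipC u). Qed.

Lemma ip_normB u v : `|u - v| ^+ 2 = `|u| ^+ 2 - 2 * ip u v + `|v| ^+ 2.
Proof. by rewrite -!ip_norm ipBl !ipBr (ipC v u); ring. Qed.

Lemma ip_cauchy_schwarz u v : `|ip u v| <= `|u| * `|v|.
Proof.
have [->|v0] := eqVneq v 0.
  have -> : ip u 0 = 0 by rewrite -(scale0r 0) ipZr mul0r.
  by rewrite !normr0 mulr0.
have nv : 0 < `|v| by rewrite normr_gt0.
have h (t : R) : 0 <= `|u| ^+ 2 - 2 * t * ip u v + t ^+ 2 * `|v| ^+ 2.
  have := sqr_ge0 `|u - t *: v|; rewrite ip_normB ipZr normrZ exprMn.
  by rewrite -normrX ger0_norm ?sqr_ge0// mulrA.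
(* This value of [t] minimises the quadratic polynomial. *)
have := h (ip u v / `|v| ^+ 2); set c := ip u v.
have -> : `|u| ^+ 2 - 2 * (c / `|v| ^+ 2) * c + (c / `|v| ^+ 2) ^+ 2 * `|v| ^+ 2 =
    (`|u| ^+ 2 * `|v| ^+ 2 - c ^+ 2) / `|v| ^+ 2.
  by move: (gt_eqF nv) => /negbT n0; field.
rewrite pmulr_lge0 ?invr_gt0 ?exprn_gt0// subr_ge0 -exprMn => le.
rewrite -(@ler_pXn2r _ 2) ?nnegrE ?mulr_ge0//.
by rewrite -normrX ger0_norm ?sqr_ge0.
Qed.

(** Polarisation expresses the inner product through the norm, whose continuity is known. *)
Lemma continuous_ip (T : topologicalType) (f g : T -> H) :
  continuous f -> continuous g -> continuous (fun x => ip (f x) (g x)).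
Proof.
move=> cf cg.
have E : (fun x => ip (f x) (g x)) =
    (fun x => (`|f x + g x| ^+ 2 - `|f x - g x| ^+ 2) / 4).
  apply/funext => x; rewrite -!ip_norm ipBl ipDl !ipBr !ipDr (ipC (g x)); lra.
rewrite E => x; apply: cvgMl; apply: cvgB; rewrite !expr2.
  by apply: cvgM; apply: cvg_norm; apply: cvgD; [exact: cf|exact: cg|exact: cf|exact: cg].
by apply: cvgM; apply: cvg_norm; apply: cvgB; [exact: cf|exact: cg|exact: cf|exact: cg].
Qed.

(* Mazur's lemma for bounded nets in a linear subspace M: if m nearly realises
   the distance from h to M, then h - m is nearly orthogonal to M. *)
Lemma weak_closure_subspace (M : set H) (h : H) (K : R) :
  M 0 -> (forall a u v, M u -> M v -> M (a *: u + v)) ->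
  (forall k (e : R), 0 < e -> exists m, [/\ M m, `|m| <= K & `|ip k (m - h)| <= e]) ->
  closure M h.
Proof.
move=> M0 MD Mweak.
have K0 : 0 <= K by have [m [_ mK _]] := Mweak 0 1 ltr01; exact: le_trans mK.
pose E := [set `|h - m| ^+ 2 | m in M].
have E0 : E !=set0 by exists (`|h - 0| ^+ 2), 0.
have lbE : has_lbound E by exists 0 => _ [m _ <-]; exact: sqr_ge0.
pose d := inf E.
have dE m : M m -> d <= `|h - m| ^+ 2 by move=> Mm; apply: ge_inf => //; exists m.
have d0 : 0 <= d by apply: lb_le_inf => // _ [m _ <-]; exact: sqr_ge0.
(* Moving [m] by [s *: n] inside M cannot bring the squared distance below [d]; the best [s] gives
   the bound. *)
have orth e m : 0 < e -> M m -> `|h - m| ^+ 2 <= d + e ->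
    forall n, M n -> ip (h - m) n ^+ 2 <= e * `|n| ^+ 2.
  move=> e0 Mm hm n Mn; have [->|n0] := eqVneq n 0.
    have -> : ip (h - m) 0 = 0 by rewrite -(scale0r 0) ipZr mul0r.
    by rewrite normr0 expr0n mulr0.
  have nn : 0 < `|n| by rewrite normr_gt0.
  have key (s : R) : 2 * s * ip (h - m) n - s ^+ 2 * `|n| ^+ 2 <= e.
    have := dE (s *: n + m) (MD _ _ _ Mn Mm).
    have -> : h - (s *: n + m) = (h - m) - s *: n.
      by rewrite opprD (addrC (- _)) addrA.
    rewrite ip_normB ipZr normrZ exprMn -normrX ger0_norm ?sqr_ge0//.
    move: hm; lra.
  have := key (ip (h - m) n / `|n| ^+ 2); set c := ip (h - m) n.
  have -> : 2 * (c / `|n| ^+ 2) * c - (c / `|n| ^+ 2) ^+ 2 * `|n| ^+ 2 =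
      c ^+ 2 / `|n| ^+ 2 by move: (gt_eqF nn) => /negbT ?; field.
  by rewrite ler_pdivrMr ?exprn_gt0.
(* For [m] nearly optimal and [n] weakly close to [h], [|h - m|^2] is the pairing of [h - m] with
   [n - m], small by near orthogonality, minus its pairing with [n - h], small by weak
   approximation. The bound [K] keeps [|n - m|] under control whatever [e] is. *)
have small e : 0 < e -> e <= 1 -> d <= Num.sqrt e * (K + `|h| + d + 1) + e.
  move=> e0 e1.
  have [_ [m Mm <-] hm] : exists2 x, E x & x < d + e by exact: inf_adherent.
  have orthm := orth _ _ e0 Mm (ltW hm).
  have [n [Mn nK ne]] := Mweak (h - m) e e0.
  have E1 : `|h - m| ^+ 2 = ip (h - m) (n - m) - ip (h - m) (n - h).
    by rewrite -ip_norm -ipBr opprB [n - m + _]addrC subrKA.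
  have Mnm : M (n - m) by rewrite addrC -scaleN1r; exact: MD.
  have le1 : ip (h - m) (n - m) <= Num.sqrt e * `|n - m|.
    apply: le_trans (ler_norm _) _.
    rewrite -(@ler_pXn2r _ 2) ?nnegrE ?mulr_ge0 ?sqrtr_ge0//.
    rewrite exprMn sqr_sqrtr ?(ltW e0)// -normrX ger0_norm ?sqr_ge0//; exact: orthm.
  have le2 : `|n - m| <= K + `|h| + d + 1.
    have hm1 : `|h - m| <= d + 1.
      have [h1|h1] := leP `|h - m| 1; first by rewrite (le_trans h1)// lerDr.
      apply: le_trans (_ : `|h - m| ^+ 2 <= _); last by move: hm; lra.
      by rewrite expr2 ler_peMl// ltW.
    have -> : n - m = n - h + (h - m) by rewrite addrA subrK.
    apply: le_trans (ler_normD _ _) _; apply: le_trans (lerD (ler_normB _ _) hm1) _.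
    by move: nK; lra.
  have le3 : Num.sqrt e * `|n - m| <= Num.sqrt e * (K + `|h| + d + 1).
    by rewrite ler_wpM2l// sqrtr_ge0.
  have := dE _ Mm; rewrite E1; move: ne; rewrite ler_norml => /andP[].
  by move: le1 le3; lra.
have d_eq0 : d = 0.
  apply/eqP; rewrite eq_le d0 andbT; apply/ler_addgt0Pr => e e0; rewrite add0r.
  pose C := K + `|h| + d + 1.
  have C0 : 0 < C by rewrite /C ltr_wpDl// !addr_ge0.
  (* [small] is used at [s ^+ 2], whose square root is [s]; its bound is then at most [s * C + s],
     hence at most [e]. *)
  pose s := Num.min 1 (e / (C + 1)).
  have s0 : 0 < s by rewrite lt_min ltr01 divr_gt0// addr_gt0.
  have s1 : s <= 1 by rewrite ge_min lexx.
  have sC : s * (C + 1) <= e.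
    by rewrite -ler_pdivlMr ?(addr_gt0 C0 ltr01)// /s ge_min lexx orbT.
  have s2 : s ^+ 2 <= s by rewrite expr2 ler_piMl// ltW.
  have := small (s ^+ 2) (exprn_gt0 _ s0) (le_trans s2 s1).
  rewrite sqrtr_sqr gtr0_norm// -/C; lra.

move=> B /nbhs_ballP[r /= r0 rB].
have [_ [m Mm <-] hm] : exists2 x, E x & x < d + r ^+ 2.
  by apply: inf_adherent => //; rewrite exprn_gt0.
exists m; split=> //; apply: rB; rewrite -ball_normE /=.
by move: hm; rewrite d_eq0 add0r ltr_pXn2r ?nnegrE// ltW.
Qed.

End inner_product.

Section right_neighbourhoods.
Context {R : realType}.

Lemma near_right0P (P : R -> Prop) : (\forall t \near 0^'+, P t) <->
  exists2 d : R, 0 < d & forall t, 0 < t < d -> P t.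
Proof.
split=> [|[d d0 dP]].
  rewrite /at_right near_withinE => /nbhs_ballP[d /= d0 dP]; exists d => //.
  move=> t /andP[t0 td]; apply: dP => //.
  by rewrite -ball_normE /= sub0r normrN gtr0_norm.
near=> t; apply: dP; apply/andP; split; near: t.
  exact: nbhs_right_gt.
exact: nbhs_right_lt.
Unshelve. all: by end_near. Qed.

End right_neighbourhoods.

(** * Orbits of a contraction semigroup and their means *)

Section semigroup_orbits.
Context {R : realType} {X : normedModType R} (S : R -> X -> X).
Hypothesis cS : banach_semigroup S.

Let norm0_eq (x y : X) : (`|x - y|%:E = 0)%E -> x = y.
Proof. by move=> /eqP; rewrite eqe normr_eq0 subr_eq0 => /eqP. Qed.

Lemma semigroupP t a u v : 0 <= t -> S t (a *: u + v) = a *: S t u + S t v.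
Proof. by move=> t0; apply: norm0_eq; exact: (semigroup_linear cS). Qed.

Lemma semigroup0 u : S 0 u = u.
Proof. by apply: norm0_eq; exact: (semigroup_0 cS). Qed.

Lemma semigroupD s t u : 0 <= s -> 0 <= t -> S (s + t) u = S s (S t u).
Proof. by move=> s0 t0; apply: norm0_eq; exact: (semigroup_add cS). Qed.

Lemma semigroup_le_norm t u : 0 <= t -> `|S t u| <= `|u|.
Proof. by move=> t0; have := semigroup_contraction cS t0 (u := u) I; rewrite lee_fin. Qed.

Lemma semigroup_right_cont u (e : R) : 0 < e -> exists2 d : R, 0 < d &
  forall t, 0 <= t < d -> `|S t u - u| < e.
Proof.
move=> e0; have := semigroup_strong_cont cS (u := u) I.
move=> /fine_cvgP[_] /cvgrPdist_lt/(_ e e0)/near_right0P[d d0 dP].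
exists d => // t /andP[]; rewrite le_eqVlt => /predU1P[<- _|t0 td].
  by rewrite semigroup0 subrr normr0.
by have := dP t; rewrite t0 td => /(_ isT); rewrite /= sub0r normrN normr_id.
Qed.

(** For [s <= t] the difference is, up to sign, [S s] applied to [S (t - s) u - u], and [S s] is a
    contraction. Right continuity at 0 thus becomes uniform continuity of the orbit. *)
Lemma semigroup_dist s t u : 0 <= s -> 0 <= t ->
  `|S s u - S t u| <= `|S `|s - t| u - u|.
Proof.
wlog st : s t / s <= t.
  move=> h s0 t0; have [st|/ltW ts] := leP s t; first exact: h.
  by rewrite distrC (distrC s); exact: h.
move=> s0 t0; have d0 : 0 <= t - s by rewrite subr_ge0.
rewrite distrC (distrC s) (ger0_norm d0) -{1}(subrKC s t) (semigroupD _ s0 d0).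
have := semigroupP (-1) u (S (t - s) u) s0.
rewrite !scaleN1r !(addrC (- _)) => <-.
exact: semigroup_le_norm.
Qed.

(** The absolute value extends the orbit to negative times, where [S] is unconstrained, so that
    integrands are continuous and bounded on the whole line. *)
Lemma continuous_orbit u : continuous (fun r : R => S `|r| u).
Proof.
move=> r; apply/cvgrPdist_lt => e e0.
have [d d0 dP] := semigroup_right_cont u e0.
apply/nbhs_ballP; exists d => //= y ryd.
apply: le_lt_trans (semigroup_dist _ _ _) _ => //.
apply: dP; rewrite normr_ge0 /=; apply: le_lt_trans ryd.
exact: ler_dist_dist.
Qed.

Variable f : X -> R.
Hypothesis df : dualspace f.

Lemma dualspace_semigroup t : 0 <= t -> dualspace (f \o S t).
Proof.
move=> t0; have [K K0 fK] := dualspace_bounded df.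
apply: (@bounded_dualspace _ _ _ K) => [a u v|u] /=.
  by rewrite semigroupP//; have [lf _] := df; exact: lf.
by apply: le_trans (fK _) _; rewrite ler_wpM2l// semigroup_le_norm//.
Qed.

Lemma continuous_dual_orbit u : continuous (fun r : R => f (S `|r| u)).
Proof.
move=> r; apply: (continuous_comp (f := fun r : R => S `|r| u)).
  exact: continuous_orbit.
by have [_ cf] := df; exact: cf.
Qed.

Lemma measurable_dual_orbit u : measurable_fun setT (fun r : R => f (S `|r| u)).
Proof. by apply: continuous_measurable_fun; apply: continuous_dual_orbit. Qed.

(** This regularises [f] into the domain of the adjoint of A. It is a scalar integral for each [u],
    since the orbit of [f] under the adjoint semigroup need not be norm continuous. *)
Definition orbit_mean (t : R) (u : X) : R :=
  t^-1 * int_upto (fun r => f (S `|r| u)) t.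

Variable K : R.
Hypotheses (K0 : 0 <= K) (fK : forall x, `|f x| <= K * `|x|).

Lemma dual_orbit_le (r : R) u : `|f (S `|r| u)| <= K * `|u|.
Proof. by apply: le_trans (fK _) _; rewrite ler_wpM2l// semigroup_le_norm//. Qed.

Lemma orbit_mean_le t u : 0 < t -> `|orbit_mean t u| <= K * `|u|.
Proof.
move=> t0; rewrite normrM normfV (gtr0_norm t0) ler_pdivrMl// mulrC.
apply: (int_upto_norm_le (ltW t0) (measurable_dual_orbit u)
  (fun r => dual_orbit_le r u)) => r _.
exact: dual_orbit_le.
Qed.

Lemma dualspace_orbit_mean t : 0 < t -> dualspace (orbit_mean t).
Proof.
move=> t0; apply: (@bounded_dualspace _ _ _ K) => [a u v|u]; last exact: orbit_mean_le.
rewrite /orbit_mean.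
have -> : int_upto (fun r => f (S `|r| (a *: u + v))) t =
    int_upto (fun r => a * f (S `|r| u) + f (S `|r| v)) t.
  by apply: eq_int_upto => r _; rewrite semigroupP//; have [lf _] := df; exact: lf.
rewrite (int_upto_linear a t (M := K * (`|u| + `|v|)));
  [by rewrite /=; ring|exact: measurable_dual_orbit| |exact: measurable_dual_orbit|].
- by move=> r; apply: le_trans (dual_orbit_le _ _) _; rewrite ler_wpM2l// lerDl.
- by move=> r; apply: le_trans (dual_orbit_le _ _) _; rewrite ler_wpM2l// lerDr.
Qed.

Lemma orbit_mean_cvg u : orbit_mean t u @[t --> 0^'+] --> f u.
Proof.
apply/cvgrPdist_le => e e0.
have cu : f (S `|r| u) @[r --> (0 : R)] --> f (S `|0 : R| u).
  exact: (@continuous_dual_orbit u (0 : R)).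
have /cvgrPdist_lt/(_ e e0)/nbhs_ballP[d /= d0 dP] := cu.
apply/near_right0P; exists d => // t /andP[t0 td].
have close r : 0 <= r <= t -> f u - e <= f (S `|r| u) <= f u + e.
  move=> /andP[r0 rt]; have := dP r; rewrite /= -ball_normE /= sub0r normrN ger0_norm//.
  move=> /(_ (le_lt_trans rt td)); rewrite normr0 semigroup0 distrC ltr_distl.
  by move=> /andP[/ltW -> /ltW ->].
have h1 := int_upto_ge (ltW t0) (measurable_dual_orbit u)
  (fun r => dual_orbit_le r u) (fun r rt => proj1 (andP (close r rt))).
have h2 := int_upto_le (ltW t0) (measurable_dual_orbit u)
  (fun r => dual_orbit_le r u) (fun r rt => proj2 (andP (close r rt))).
rewrite distrC ler_distl /orbit_mean.
by rewrite ler_pdivlMl// ler_pdivrMl// !(mulrC t) h1 h2.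
Qed.

(* Both sides are [\int_0^(s+t) - \int_0^s - \int_0^t] of the orbit of u. *)
Lemma orbit_mean_exchange s t u : 0 < s -> 0 < t ->
  t^-1 * (orbit_mean s (S t u) - orbit_mean s u) =
  s^-1 * (orbit_mean t (S s u) - orbit_mean t u).
Proof.
move=> s0 t0.
have shift a b : 0 < a -> 0 < b -> int_upto (fun r => f (S `|r| (S a u))) b =
    int_upto (fun r => f (S `|r| u)) (a + b) - int_upto (fun r => f (S `|r| u)) a.
  move=> a0 b0; rewrite (@int_upto_add _ _ (K * `|u|)) ?ltW//; last 2 first.
  - exact: measurable_dual_orbit.
  - by move=> r; exact: dual_orbit_le.
  rewrite addrC addKr; apply: eq_int_upto => r r0.
  by have a1 := ltW a0; rewrite !ger0_norm ?addr_ge0// [a + r]addrC semigroupD.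
rewrite /orbit_mean !shift// (addrC s t); ring.
Qed.

(** After the exchange of [s] and [t], the variable [t] occurs only as the length of a mean, and
    means over short intervals converge to [f]. No assumption on [u] enters, such as membership in
    the domain of the generator. *)
Lemma orbit_mean_derivative s u : 0 < s ->
  t^-1 * (orbit_mean s (S t u) - orbit_mean s u) @[t --> 0^'+] -->
  s^-1 * (f (S s u) - f u).
Proof.
move=> s0.
have : s^-1 * (orbit_mean t (S s u) - orbit_mean t u) @[t --> 0^'+] -->
    s^-1 * (f (S s u) - f u).
  by apply: cvgMr; apply: cvgB; exact: orbit_mean_cvg.
apply: cvg_trans; apply: near_eq_cvg; near=> t.
by rewrite [RHS]orbit_mean_exchange//; near: t; exact: nbhs_right_gt.
Unshelve. all: by end_near. Qed.

Lemma dual_generator u v : generator setT (fun x => `|x|%:E) S u v ->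
  t^-1 * (f (S t u) - f u) @[t --> 0^'+] --> f v.
Proof.
move=> [_ _ /fine_cvgP[_] /cvgrPdist_lt lim]; have [lf _] := df.
have K1 : 0 < K + 1 by rewrite ltr_wpDl.
apply/cvgrPdist_le => e e0.
have := lim _ (divr_gt0 e0 K1); apply: filterS => t.
rewrite /= sub0r normrN normr_id ltr_pdivlMr// => lt.
rewrite distrC -(scalar_sub lf) -(scalar_scale lf) -(scalar_sub lf).
apply: le_trans (fK _) _; apply: ltW; apply: le_lt_trans lt.
by rewrite mulrC ler_wpM2l// lerDl.
Qed.

End semigroup_orbits.

(** * The Lyapunov inequality and coercivity *)

Section coercivity.
Context {R : realType} {X : normedModType R} {H : completeNormedModType R}.
Variables (Q : (X -> R) -> X) (DA : set X) (A : X -> X) (S : R -> X -> X)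
  (Qt : R -> (X -> R) -> X) (Qinf : (X -> R) -> X) (mu : probability (borel X) R)
  (ip : {dot H for idfun}) (i : {linear H -> X}) (istar : (X -> R) -> H)
  (B : {linear H -> H}).
Hypotheses (cS : banach_semigroup S) (gA : generates DA A S)
  (Qt_def : is_Qt Q S Qt)
  (Qinf_def : forall f g, dualspace f -> dualspace g ->
     g (Qt t f) @[t --> +oo] --> g (Qinf f))
  (mu_covariance : is_covariance mu Qinf)
  (H_rkhs : is_rkhs Q ip i istar)
  (B_continuous : continuous B)
  (B_def : forall f g, adjoint_op DA A f g -> i (B (istar f)) = Qinf g).

Let ipn := rkhs_norm H_rkhs.
Let ipadj f h : dualspace f -> ip (istar f) h = f (i h) :=
  @rkhs_adjoint _ _ _ _ _ _ _ H_rkhs f h.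

(** Linearity of [istar] follows from the adjoint relation: the defect is orthogonal to every
    vector, in particular to itself. *)
Lemma istar_comb (a : R) f g : dualspace f -> dualspace g ->
  istar (a *: f + g) = a *: istar f + istar g.
Proof.
move=> df dg; apply/eqP; rewrite -subr_eq0 -normr_eq0 -sqrf_eq0 -ipn.
set h := _ - _; rewrite {1}/h ipBl ipDl ipZl !ipadj//; last exact: dualspace_comb.
by rewrite (_ : (a *: f + g) (i h) = a * f (i h) + g (i h))// subrr.
Qed.

(** [Ki] bounds the norm of [i], and the square of [|istar f|] is [f (i (istar f))]. The bound
    depends on [f] only through [K], hence is uniform along orbits and means. *)
Lemma istar_bounded : exists2 Ki : R, 0 <= Ki & forall f (K : R),
  dualspace f -> 0 <= K -> (forall x, `|f x| <= K * `|x|) -> `|istar f| <= K * Ki.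
Proof.
have [Ki Ki0 iK] := continuous_linear_norm_bound (rkhs_continuous H_rkhs).
exists Ki => // f K df K0 fK; have [->|h0] := eqVneq (istar f) 0.
  by rewrite normr0 mulr_ge0.
have nh : 0 < `|istar f| by rewrite normr_gt0.
rewrite -(ler_pM2r nh) -expr2 -ipn ipadj// -mulrA.
apply: le_trans (ler_norm _) _; apply: le_trans (fK _) _.
by apply: ler_wpM2l.
Qed.

(** For [s >= 0] this is the integrand of [f (Qt t f)]; it is a squared norm in H by [QorbitE]. *)
Definition Qorbit f (s : R) : R := f (S `|s| (Q (f \o S `|s|))).

Lemma QorbitE f s : dualspace f -> Qorbit f s = `|istar (f \o S `|s|)| ^+ 2.
Proof.
move=> df; rewrite -ipn ipadj; last exact: dualspace_semigroup.
by rewrite (rkhs_factor H_rkhs)//; exact: dualspace_semigroup.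
Qed.

(* [Qorbit f s] is the supremum over h of [2 f (S_s (i h)) - |h|^2], hence
   lower semicontinuous in s. *)
Lemma Qorbit_lsc f : dualspace f -> lower_semicontinuous (EFin \o Qorbit f).
Proof.
move=> df s0 a; rewrite /= lte_fin => aF.
pose h0 := istar (f \o S `|s0|).
(* This expands [|istar (f \o S |s|) - h0|^2 >= 0], with equality at [s = s0]; the left side is
   continuous in [s]. *)
have lower s : 2 * f (S `|s| (i h0)) - `|h0| ^+ 2 <= Qorbit f s.
  have ds : dualspace (f \o S `|s|) by exact: dualspace_semigroup.
  rewrite QorbitE// -subr_ge0.
  have := sqr_ge0 `|istar (f \o S `|s|) - h0|.
  by rewrite (ip_normB ipn) ipadj//=; lra.
have ds0 : dualspace (f \o S `|s0|) by exact: dualspace_semigroup.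
have E0 : 2 * f (S `|s0| (i h0)) - `|h0| ^+ 2 = Qorbit f s0.
  rewrite QorbitE// -/h0.
  have -> : f (S `|s0| (i h0)) = `|h0| ^+ 2 by rewrite -ipn {1}/h0 ipadj.
  by ring.
have cont : 2 * f (S `|s| (i h0)) - `|h0| ^+ 2 @[s --> s0] --> Qorbit f s0.
  rewrite -E0; apply: cvgB; last exact: cvg_cst.
  by apply: cvgMr; exact: (@continuous_dual_orbit _ _ _ cS _ df (i h0) s0).
exists [set s | a < 2 * f (S `|s| (i h0)) - `|h0| ^+ 2].
  by move: cont => /cvgr_gt; apply.
by move=> s /= h; rewrite lte_fin; exact: lt_le_trans (lower s).
Qed.

Lemma measurable_Qorbit f : dualspace f -> measurable_fun setT (Qorbit f).
Proof.
by move=> /Qorbit_lsc/lower_semicontinuous_measurable/measurable_EFinP.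
Qed.

Lemma Qorbit_bounded f : dualspace f -> exists M : R, forall s, `|Qorbit f s| <= M.
Proof.
move=> df; have [K K0 fK] := dualspace_bounded df.
have [Ki Ki0 iK] := istar_bounded.
exists ((K * Ki) ^+ 2) => s; rewrite QorbitE// ger0_norm ?sqr_ge0//.
rewrite ler_pXn2r ?nnegrE ?mulr_ge0//; apply: iK => //.
  exact: dualspace_semigroup.
by move=> x /=; exact: (dual_orbit_le cS K0 fK).
Qed.

Lemma QtE f t : dualspace f -> 0 < t -> f (Qt t f) = int_upto (Qorbit f) t.
Proof.
move=> df t0; rewrite Qt_def//; apply: eq_Rintegral => s.
by rewrite inE /= in_itv /= => /andP[s0 _]; rewrite /Qorbit ger0_norm.
Qed.

Lemma QtD f s t : dualspace f -> 0 < s -> 0 < t ->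
  f (Qt (t + s) f) = f (Qt t f) + (f \o S t) (Qt s (f \o S t)).
Proof.
move=> df s0 t0; have dft : dualspace (f \o S t).
  by apply: dualspace_semigroup => //; exact: ltW.
have [M FM] := Qorbit_bounded df.
rewrite (QtE dft s0) (QtE df t0) (QtE df (addr_gt0 t0 s0)).
rewrite (@int_upto_add _ _ M) ?ltW//; last exact: measurable_Qorbit.
congr (_ + _); apply: eq_int_upto => r r0; rewrite /Qorbit /=.
have t1 := ltW t0; rewrite !ger0_norm ?addr_ge0// (semigroupD cS)//.
congr (f (S t (S r (Q _)))); apply/funext => x /=.
by rewrite (semigroupD cS).
Qed.

(** Invariance of the limit covariance, as an identity of quadratic forms: [s] tends to infinity in
    [QtD], and the two sides have the two expressions as limits. *)
Lemma Qinf_split f t : dualspace f -> 0 < t ->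
  f (Qinf f) = f (Qt t f) + (f \o S t) (Qinf (f \o S t)).
Proof.
move=> df t0; have dft : dualspace (f \o S t).
  by apply: dualspace_semigroup => //; exact: ltW.
have L1 : f (Qt (t + s) f) @[s --> +oo] --> f (Qinf f).
  apply: (@cvg_comp _ _ _ (fun s => t + s) (fun r => f (Qt r f)) _ (+oo_R)).
    apply/cvgryPge => M; near=> s; rewrite -lerBlDl; near: s.
    by apply: nbhs_pinfty_ge; exact: num_real.
  exact: Qinf_def.
have L2 : f (Qt t f) + (f \o S t) (Qt s (f \o S t)) @[s --> +oo] -->
    f (Qt t f) + (f \o S t) (Qinf (f \o S t)).
  by apply: cvgD; [exact: cvg_cst|exact: Qinf_def].
have L3 : f (Qt t f) + (f \o S t) (Qt s (f \o S t)) @[s --> +oo] --> f (Qinf f).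
  apply: cvg_trans L1; apply: near_eq_cvg.
  have : \forall s \near +oo_R, 0 < s by apply: nbhs_pinfty_gt; exact: num_real.
  by apply: filterS => s s0; exact: QtD.
exact: (cvg_unique _ L3 L2).
Unshelve. all: by end_near. Qed.

Lemma Qinf_sym f g : dualspace f -> dualspace g -> g (Qinf f) = f (Qinf g).
Proof.
move=> df dg; rewrite !mu_covariance//; apply: eq_Rintegral => x _.
by rewrite mulrC.
Qed.

Lemma Qinf_ge0 f : dualspace f -> 0 <= f (Qinf f).
Proof.
move=> df; rewrite mu_covariance//; apply: Rintegral_ge0 => x _.
by rewrite -expr2 sqr_ge0.
Qed.

(* Positivity of [Qinf] on [f o S t - f] turns the invariance identity
   [Qinf_split] into a one-sided bound with no second-order term. *)
Lemma Qt_le f t : dualspace f -> 0 < t ->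
  f (Qt t f) <= - 2 * (f (S t (Qinf f)) - f (Qinf f)).
Proof.
move=> df t0; have dft : dualspace (f \o S t).
  by apply: dualspace_semigroup => //; exact: ltW.
have dk := dualspace_comb (-1) df dft.
have := Qinf_ge0 dk; set k := -1 *: f + (f \o S t) in dk *.
have kE x : k x = f (S t x) - f x.
  rewrite /k; change (-1 * f x + f (S t x) = f (S t x) - f x).
  by rewrite mulN1r addrC.
have h1 : f (S t (Qinf k)) = k (Qinf (f \o S t)) := Qinf_sym dk dft.
have h2 : f (Qinf k) = k (Qinf f) := Qinf_sym dk df.
have h3 : f (Qinf (f \o S t)) = f (S t (Qinf f)) := Qinf_sym dft df.
rewrite kE h1 h2 !kE h3; have := Qinf_split df t0.
rewrite /=; lra.
Qed.

Lemma Qt_ge f (e : R) : dualspace f -> 0 < e ->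
  \forall t \near 0^'+, (`|istar f| ^+ 2 - e) * t <= f (Qt t f).
Proof.
move=> df e0; have F0 : Qorbit f 0 = `|istar f| ^+ 2.
  rewrite QorbitE// normr0; congr (`|istar _| ^+ 2); apply/funext => x /=.
  by rewrite (semigroup0 cS).
have [|V] := @Qorbit_lsc f df 0 (`|istar f| ^+ 2 - e).
  by rewrite /= lte_fin F0 ltrBlDr ltrDl.
move=> /nbhs_ballP[d /= d0 dV] VF.
apply/near_right0P; exists d => //. move=> t /andP[t0 td].
have [M FM] := Qorbit_bounded df.
rewrite QtE//; apply: (int_upto_ge (ltW t0) (measurable_Qorbit df) FM).
move=> r /andP[r0 rt]; apply: ltW; rewrite -lte_fin; apply: VF; apply: dV.
by rewrite -ball_normE /= sub0r normrN ger0_norm//; exact: le_lt_trans td.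
Qed.

Lemma lyapunov_le f (l : R) : dualspace f ->
  t^-1 * (f (S t (Qinf f)) - f (Qinf f)) @[t --> 0^'+] --> l ->
  `|istar f| ^+ 2 <= - 2 * l.
Proof.
move=> df /cvgrPdist_lt lim; apply/ler_addgt0Pr => e e0.
(* One third of [e] goes to the lower bound on [Qt], two thirds to the difference quotient, which
   enters with the factor 2. *)
have e30 : 0 < e / 3 by rewrite divr_gt0.
have [t [t0 h1 h2]] : exists t : R, [/\ 0 < t,
    (`|istar f| ^+ 2 - e / 3) * t <= f (Qt t f) &
    `|l - t^-1 * (f (S t (Qinf f)) - f (Qinf f))| < e / 3].
  apply: (@filter_ex _ (0^'+)); near=> t; split.
  - by near: t; exact: nbhs_right_gt.
  - by near: t; exact: Qt_ge.
  - by near: t; exact: lim.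
have := le_trans h1 (Qt_le df t0); rewrite -ler_pdivlMr//.
rewrite -mulrA (mulrC _ t^-1); move: h2; rewrite ltr_norml => /andP[].
by lra.
Unshelve. all: by end_near. Qed.

(** The limit is required at every [x], not only on [DA], because it is taken at [Qinf f] in
    [adjoint_core_coercive]. *)
Definition adjoint_core f := dualspace f /\ exists g, adjoint_op DA A f g /\
  forall x, t^-1 * (f (S t x) - f x) @[t --> 0^'+] --> g x.

Lemma adjoint_core_comb (a : R) f g : adjoint_core f -> adjoint_core g ->
  adjoint_core (a *: f + g).
Proof.
move=> [df [f' [[_ df' fA] flim]]] [dg [g' [[_ dg' gA'] glim]]].
have dfg := dualspace_comb a df dg; split=> //.
exists (a *: f' + g'); split; first split=> // [|x DAx].
- exact: dualspace_comb.
- by rewrite [LHS](_ : _ = a * f (A x) + g (A x))// fA// gA'.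
move=> x; have : a * (t^-1 * (f (S t x) - f x)) + t^-1 * (g (S t x) - g x)
    @[t --> 0^'+] --> a * f' x + g' x.
  by apply: cvgD; [apply: cvgMr; exact: flim|exact: glim].
apply: cvg_trans; apply: near_eq_cvg; apply: nearW => t.
rewrite [LHS](_ : _ = t^-1 * ((a * f (S t x) + g (S t x)) - (a * f x + g x)))//.
by ring.
Qed.

Lemma adjoint_core_coercive f : adjoint_core f ->
  `|istar f| ^+ 2 <= - 2 * ip (B (istar f)) (istar f).
Proof.
move=> [df [g [fg flim]]]; have [_ dg _] := fg.
have -> : ip (B (istar f)) (istar f) = g (Qinf f).
  by rewrite ipC ipadj// (B_def fg) Qinf_sym.
exact: lyapunov_le.
Qed.

Lemma adjoint_core_mean f t : dualspace f -> 0 < t -> adjoint_core (orbit_mean S f t).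
Proof.
move=> df t0; have [K K0 fK] := dualspace_bounded df.
have dm := dualspace_orbit_mean cS df K0 fK t0.
have dft : dualspace (f \o S t) by apply: dualspace_semigroup => //; exact: ltW.
split=> //; exists (t^-1 *: (f \o S t - f)); split; last first.
  by move=> x; exact: (orbit_mean_derivative cS df K0 fK).
have dd : dualspace (f \o S t - f).
  rewrite (_ : _ - _ = -1 *: f + (f \o S t)); first exact: dualspace_comb.
  by rewrite scaleN1r addrC.
split=> //.
  (* A plain multiple is written as [(c - 1) k + k] to match the form of [dualspace_comb]. *)
  have := dualspace_comb (t^-1 - 1) dd dd; congr dualspace.
  by rewrite scalerBl scale1r subrK.
move=> x DAx; have [/(_ (conj DAx erefl)) gx _] := gA x (A x).
have mK y := orbit_mean_le cS df K0 fK y t0.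
(* On [DA] the same difference quotient tends to the mean at [A x], by definition of the generator,
   and to the closed form; equality of the limits is the adjoint relation. *)
have L1 := dual_generator dm K0 mK gx.
have L2 := orbit_mean_derivative cS df K0 fK (u := x) t0.
exact: (cvg_unique _ L1 L2).
Qed.

Lemma coercive_closed : closed [set h | `|h| ^+ 2 <= - 2 * ip (B h) h].
Proof.
have cB : continuous (fun h : H => - 2 * ip (B h) h - `|h| ^+ 2).
  move=> h; apply: cvgB.
    by apply: cvgMr; apply: (continuous_ip ipn) => // x; exact: cvg_id.
  by rewrite expr2; apply: cvgM; apply: cvg_norm; exact: cvg_id.
rewrite (_ : mkset _ = (fun h => - 2 * ip (B h) h - `|h| ^+ 2) @^-1` [set y | 0 <= y]).
  by apply: closed_comp => [h _|]; [exact: cB|exact: closed_ge].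
by apply/seteqP; split=> h /=; rewrite subr_ge0.
Qed.

(** The images of the means are bounded by [K * Ki], and their pairing with [k] is the mean at
    [i k], which tends to [f (i k)]; this is the weak approximation that [weak_closure_subspace]
    asks for. *)
Lemma istar_in_closure f : dualspace f ->
  closure [set istar g | g in adjoint_core] (istar f).
Proof.
move=> df; have [K K0 fK] := dualspace_bounded df.
have [Ki Ki0 iK] := istar_bounded.
apply: (weak_closure_subspace ipn (K := K * Ki)).
- have m1 := adjoint_core_mean df (ltr01 : 0 < 1 :> R).
  exists (-1 *: orbit_mean S f 1 + orbit_mean S f 1); first exact: adjoint_core_comb.
  have [dm _] := m1; rewrite istar_comb// scaleN1r addrC subrr //.
- move=> a _ _ [u cu <-] [v cv <-]; exists (a *: u + v); first exact: adjoint_core_comb.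
  by have [[du _] [dv _]] := (cu, cv); rewrite istar_comb.
move=> k e e0.
have /cvgrPdist_lt/(_ e e0) lim := orbit_mean_cvg cS df K0 fK (u := i k).
have [t [t0 ht]] : exists t : R, 0 < t /\ `|f (i k) - orbit_mean S f t (i k)| < e.
  apply: (@filter_ex _ (0^'+)); near=> t; split; last by near: t.
  by near: t; exact: nbhs_right_gt.
have cm := adjoint_core_mean df t0; have [dm _] := cm.
exists (istar (orbit_mean S f t)); split; first by exists (orbit_mean S f t).
  by apply: iK => // x; exact: (orbit_mean_le cS df K0 fK).
by rewrite ipC ipBl !ipadj// distrC ltW.
Unshelve. all: by end_near. Qed.

Lemma coercivity h : `|h| ^+ 2 <= - 2 * ip (B h) h.
Proof.
have cC := coercive_closed; set C := [set h | _] in cC.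
have core_C : closure [set istar g | g in adjoint_core] `<=` C.
  rewrite (closure_id C).1//; apply: closure_subset => _ [g cg <-].
  exact: adjoint_core_coercive.
apply: contrapT => hC.
have [] := rkhs_dense H_rkhs (O := ~` C) _ _; first by exists h.
  exact: closed_openC.
move=> x [nC [f df fE]]; apply: nC; rewrite -fE.
by apply: core_C; exact: istar_in_closure.
Qed.

End coercivity.

(** * Lp spaces and consistency of the semigroups *)

Section Lp_spaces.
Context {R : realType} {X : normedModType R}.
Variable nu : {measure set (borel X) -> \bar R}.
Implicit Types (f g u v : X -> R) (p q : R).

Local Notation mfun f := (measurable_fun [set: borel X] (f : borel X -> R)).

Lemma LpP p f : Lp nu p f <-> mfun f /\ (LpN nu p f < +oo)%E.
Proof.
rewrite /Lp /= /Lfun inE /=; split.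
  by move=> /andP[]; rewrite !inE.
by move=> [mf nf]; apply/andP; rewrite !inE.
Qed.

Lemma Lp_measurable p f : Lp nu p f -> mfun f.
Proof. by move=> /LpP[]. Qed.

Lemma Lp_finite p f : Lp nu p f -> (LpN nu p f < +oo)%E.
Proof. by move=> /LpP[]. Qed.

Lemma LpN_ge0 p f : (0 <= LpN nu p f)%E.
Proof. exact: Lnorm_ge0. Qed.

Lemma LpN_triangle p f g : mfun f -> mfun g -> 1 <= p ->
  (LpN nu p (f + g)%R <= LpN nu p f + LpN nu p g)%E.
Proof. exact: minkowski_EFin. Qed.

Lemma LpNN p f : LpN nu p (- f) = LpN nu p f.
Proof.
exact: (oppe_Lnorm nu (EFin \o (f : borel X -> R)) p%:E).
Qed.

Lemma LpNB_sym p f g : LpN nu p (f - g) = LpN nu p (g - f).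
Proof. by rewrite -LpNN opprB. Qed.

Lemma LpN_triangle_sub p f g h : mfun f -> mfun g -> mfun h -> 1 <= p ->
  (LpN nu p (f - h)%R <= LpN nu p (f - g)%R + LpN nu p (g - h)%R)%E.
Proof.
move=> mf mg mh p1.
have -> : f - h = (f - g) + (g - h) by rewrite addrA subrK.
by apply: LpN_triangle => //; exact: measurable_funB.
Qed.

Lemma Lp_add p f g : 1 <= p -> Lp nu p f -> Lp nu p g -> Lp nu p (f + g).
Proof.
move=> p1 /LpP[mf nf] /LpP[mg ng]; apply/LpP; split.
  exact: measurable_funD.
by apply: le_lt_trans (LpN_triangle mf mg p1) _; rewrite lte_add_pinfty.
Qed.

Lemma Lp_opp p f : Lp nu p f -> Lp nu p (- f).
Proof.
move=> /LpP[mf nf]; apply/LpP; split; last by rewrite LpNN.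
exact: measurableT_comp.
Qed.

Lemma Lp_sub p f g : 1 <= p -> Lp nu p f -> Lp nu p g -> Lp nu p (f - g).
Proof. by move=> p1 lf lg; apply: Lp_add => //; exact: Lp_opp. Qed.

Lemma Lp_scale p (a : R) f : 1 <= p -> Lp nu p f -> Lp nu p (a *: f).
Proof.
move=> p1 lf; have -> : a *: f = a \o* f by apply/funext => x /=; rewrite mulrC.
exact: (@Lfun_scale _ _ _ nu f a p p1 lf).
Qed.

Lemma LpNE p f :
  LpN nu p f = ((\int[nu]_x (`|f x| `^ p)%:E) `^ p^-1)%E.
Proof. by rewrite /LpN unlock. Qed.

Lemma measurable_norm_powR p f : mfun f -> mfun (fun x => `|f x| `^ p).
Proof.
move=> mf; apply: (@measurableT_comp _ _ _ _ _ _ (@powR R ^~ p)) => //.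
exact: measurableT_comp.
Qed.

Lemma ae_imp (P Q : X -> Prop) : (forall x, P x -> Q x) ->
  {ae nu, forall x, P x} -> {ae nu, forall x, Q x}.
Proof. by move=> PQ; apply: (@filterS _ _ (ae_filter_ringOfSetsType nu)). Qed.

Lemma ae_and (P Q : X -> Prop) : {ae nu, forall x, P x} ->
  {ae nu, forall x, Q x} -> {ae nu, forall x, P x /\ Q x}.
Proof. exact: (@filterI _ _ (ae_filter_ringOfSetsType nu)). Qed.

Lemma LpN_ae p f g : mfun f -> mfun g -> f = g %[ae nu] ->
  LpN nu p f = LpN nu p g.
Proof.
move=> mf mg fg; rewrite !LpNE; congr (_ `^ _)%E.
apply: (ae_eq_integral _ _ measurableT).
- by have /measurable_EFinP := measurable_norm_powR p mf.
- by have /measurable_EFinP := measurable_norm_powR p mg.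
by move: fg; apply: ae_imp => x /(_ I) /= ->.
Qed.

Lemma LpN0_ae p f : 0 < p -> mfun f -> LpN nu p f = 0%E -> f = cst 0 %[ae nu].
Proof.
move=> p0 mf /Lnorm_eq0_eq0.
have /measurable_EFinP mf' := mf.
move=> /(_ mf'); rewrite lte_fin => /(_ p0).
by apply: ae_imp => x /(_ I) [].
Qed.

Lemma LpNB0_ae p f g : 0 < p -> mfun f -> mfun g -> LpN nu p (f - g) = 0%E ->
  f = g %[ae nu].
Proof.
move=> p0 mf mg /(LpN0_ae p0 (measurable_funB mf mg)).
by apply: ae_imp => x h xT; apply/eqP; rewrite -subr_eq0; apply/eqP; exact: h.
Qed.

Lemma ae_LpNB0 p f g : 0 < p -> mfun f -> mfun g -> f = g %[ae nu] ->
  LpN nu p (f - g) = 0%E.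
Proof.
move=> p0 mf mg fg; have -> : LpN nu p (f - g) = LpN nu p (cst 0).
  apply: LpN_ae => //; first exact: measurable_funB.
  by move: fg; apply: ae_imp => x h _; rewrite fctE h// subrr.
by rewrite /LpN; apply: Lnorm0; rewrite eqe gt_eqF.
Qed.

Hypothesis nu_fin : (nu setT < +oo)%E.

Lemma Lp_subset p q : 1 <= p -> p <= q -> Lp nu q `<=` Lp nu p.
Proof.
move=> p1 pq f; apply: (@Lfun_subset _ _ _ nu p%:E q%:E) => //.
- by rewrite lee_fin (le_trans p1).
- by rewrite ge0_fin_numE.
Qed.

(** Hölder's inequality for [|f|^p] and the constant 1, with exponent [r = q / p], gives C as the
    total mass to the power [1/p - 1/q]. The case [p = q] is separate, as [r = 1] has no finite
    conjugate exponent. *)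
Lemma LpN_le p q : 1 <= p -> p <= q -> exists2 C : R, 0 <= C &
  forall f, mfun f -> (LpN nu p f <= C%:E * LpN nu q f)%E.
Proof.
move=> p1; rewrite le_eqVlt => /predU1P[<-|pq].
  by exists 1 => // f _; rewrite mul1e.
have p0 : (0 < p)%R by rewrite (lt_le_trans ltr01).
have q0 : (0 < q)%R by rewrite (lt_trans p0).
pose r := (q / p)%R.
pose r' := (1 - r^-1)^-1%R.
have r0 : (0 < r)%R by rewrite/r divr_gt0.
have r'0 : (0 < r')%R.
  by rewrite /r' invr_gt0 subr_gt0 invf_lt1 ?(lt_trans ltr01)//;
      rewrite /r ltr_pdivlMr// mul1r.
have rr'1 : (r^-1 + r'^-1 = 1)%R by rewrite /r' /r invf_div invrK subrKC.
have nuf : nu setT \is a fin_num by rewrite ge0_fin_numE.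
set c := ((nu setT `^ r'^-1) `^ p^-1)%E.
have cE : c = (fine c)%:E by rewrite fineK// !fin_num_poweR// !poweR_ge0.
exists (fine c); first by rewrite fine_ge0// poweR_ge0.
move=> f mf; rewrite -cE.
have mfp := measurable_norm_powR p mf.
have := @hoelder _ _ _ nu (fun x => `|f x| `^ p)%R (cst 1)%R r r' mfp
  (measurable_cst _) r0 r'0 rr'1.
have -> : (((fun x : borel X => `|f x| `^ p) \* cst 1) =
  (fun x : borel X => `|f x| `^ p))%R by apply/funext => x /=; rewrite mulr1.
rewrite Lnorm_cst1 Lnorm1 => h.
rewrite !LpNE.
have -> : (\int[nu]_x (`|f x| `^ p)%:E = \int[nu]_x `|(`|f x| `^ p)%:E|)%E.
  by apply: eq_integral => x _; rewrite gee0_abs// lee_fin powR_ge0.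
apply: (le_trans (gt0_ler_poweR _ _ _ h)).
- by rewrite invr_ge0 ltW.
- by rewrite in_itv /= leey integral_ge0.
- by rewrite in_itv /= leey mule_ge0 ?Lnorm_ge0 ?poweR_ge0.
rewrite muleC poweRM ?Lnorm_ge0 ?poweR_ge0//.
apply: lee_wpmul2l; first exact: poweR_ge0.
have rp : (r^-1 * p^-1 = q^-1)%R.
  by rewrite /r invf_div mulrAC divff ?mul1r// gt_eqF.
rewrite unlock -poweRrM rp.
rewrite le_eqVlt; apply/orP; left; apply/eqP; congr (_ `^ _)%E.
apply: eq_integral => x _; congr EFin.
by rewrite ger0_norm ?powR_ge0// -powRrM mulrCA divff ?gt_eqF// mulr1.
Qed.

End Lp_spaces.

Section ereal_limits.
Context {R : realType} {I : Type} {F : set_system I} {FF : Filter F}.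
Local Open Scope ereal_scope.

Lemma cvge0_lt (u : I -> \bar R) (e : R) : u x @[x --> F] --> 0 -> (0 < e)%R ->
  \forall x \near F, u x < e%:E.
Proof.
move=> u0 e0; apply: (u0 [set y : \bar R | y < e%:E]).
apply: open_nbhs_nbhs; split.
  exact: open_ereal_lt_ereal.
by rewrite /= lte_fin.
Qed.

Lemma cvge0_le_scale (u v : I -> \bar R) (C : R) :
  (forall x, 0 <= u x) -> (\forall x \near F, u x <= C%:E * v x) ->
  v x @[x --> F] --> 0 -> u x @[x --> F] --> 0.
Proof.
move=> u0 uv v0; apply: (@squeeze_cvge _ _ _ _ (cst 0) _ (fun x => C%:E * v x)).
- by apply: filterS uv => x ->; rewrite u0.
- exact: cvg_cst.
- by rewrite -[X in _ --> X](mule0 C%:E); exact: cvgeZl.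
Qed.

End ereal_limits.

(** * Agreement of the semigroups and inclusion of the generators *)

Section consistency.
Context {R : realType} {X : normedModType R}.
Variable nu : {measure set (borel X) -> \bar R}.
Implicit Types (f g u v : X -> R) (p q : R).
Local Notation mfun f := (measurable_fun [set: borel X] (f : borel X -> R)).

Hypothesis nu_fin : (nu setT < +oo)%E.

Lemma Lp_bounded p f (M : R) : 1 <= p -> mfun f -> (forall x, `|f x| <= M) ->
  Lp nu p f.
Proof.
move=> p1 mf fM; apply/LpP; split => //.
have p0 : 0 < p by rewrite (lt_le_trans ltr01).
rewrite LpNE poweR_lty//.
apply: (@le_lt_trans _ _ (\int[nu]_x (cst (M `^ p)%:E x))%E).
  have /measurable_EFinP mp := measurable_norm_powR p mf.
  apply: ge0_le_integral => //.
  move=> x _; rewrite lee_fin; apply: ge0_ler_powR; rewrite ?nnegrE //; first exact: ltW.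
  exact: le_trans (normr_ge0 _) (fM x).
by rewrite integral_cst// lte_mul_pinfty// lee_fin powR_ge0.
Qed.

Lemma bounded_dense_Lp q f (e : R) : 1 <= q -> Lp nu q f -> 0 < e ->
  exists h, [/\ mfun h, exists M : R, forall x, `|h x| <= M &
    (LpN nu q (f - h)%R <= e%:E)%E].
Proof.
move=> q1 fq e0; have mf := Lp_measurable fq.
have q0 : 0 < q by rewrite (lt_le_trans ltr01).
(* Large values are cut to 0 rather than clamped: [|f - h n|] is then 0 or [|f|], so [|f|^q]
   dominates, and at each point the difference vanishes once [n] exceeds [|f x|]. *)
pose h (n : nat) (x : X) : R := if `|f x| <= n%:R then f x else 0.
have mh n : mfun (h n).
  apply: (measurable_fun_ifT (f := fun x : borel X => `|f x| <= n%:R)) => //.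
  by apply: measurable_fun_ler => //; exact: measurableT_comp.
have mfh n : mfun (f - h n) by exact: measurable_funB.
have [] := @dominated_convergence _ (borel X) _ nu setT measurableT
  (fun n x => (`|(f - h n) x| `^ q)%:E) (cst 0%E) (fun x => (`|f x| `^ q)%:E).
- by move=> n; have /measurable_EFinP := measurable_norm_powR q (mfh n).
- by [].
- apply: aeW => x _.
  have : (\forall n \near \oo, (`|(f - h n) x| `^ q)%:E = 0%E); last first.
    by move=> nx; apply: cvg_trans (near_eq_cvg _) (cvg_cst _); apply: filterS nx => n ->.
  exists `|Num.ceil `|f x| |%N => // n /= fxn.
  rewrite (_ : (f - h n) x = f x - h n x)// /h ifT ?subrr ?normr0 ?powR0 ?gt_eqF//.
  apply: le_trans (Num.Theory.ceil_ge _) _.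
  by rewrite -(ler_nat R) in fxn; apply: le_trans fxn; rewrite natr_absz ler_int ler_norm.
- exact: (@Lfun_integrable _ _ _ nu f q q1 fq).
- apply: aeW => x n _; rewrite lee_fin ger0_norm ?powR_ge0//.
  apply: ge0_ler_powR; rewrite ?nnegrE//; first exact: ltW.
  rewrite (_ : (f - h n) x = f x - h n x)// /h.
  by case: ifP => _; rewrite ?subrr ?normr0 ?subr0.
move=> _ _; rewrite integral_cst// mul0e => /cvge0_lt.
have eq0 : 0 < e `^ q by rewrite powR_gt0.
move=> /(_ _ eq0)[n _ /(_ n (leqnn n))/= ltn].
exists (h n); split => //.
  by exists n%:R => x; rewrite /h; case: ifP => //; rewrite normr0.
rewrite LpNE.
have -> : e%:E = ((e `^ q)%:E `^ q^-1)%E.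
  by rewrite poweR_EFin -powRrM divff ?gt_eqF// powRr1 ?ltW.
apply: gt0_ler_poweR; last exact: ltW.
- by rewrite invr_ge0 ltW.
- by rewrite in_itv/= leey integral_ge0// => x _; rewrite lee_fin powR_ge0.
- by rewrite in_itv/= leey lee_fin powR_ge0.
Qed.

Section contraction.
Variables (p : R) (S : R -> (X -> R) -> X -> R).
Hypotheses (p1 : 1 <= p) (cS : contraction_semigroup (Lp nu p) (LpN nu p) S).

(** The semigroup is linear only up to functions of norm 0, so contractivity on [u - v] is
    transferred through the triangle inequality. *)
Lemma contraction_dist t u v : 0 <= t -> Lp nu p u -> Lp nu p v ->
  (LpN nu p (S t u - S t v)%R <= LpN nu p (u - v)%R)%E.
Proof.
move=> t0 up vp.
have lin := semigroup_linear cS (-1) t0 vp up.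
have uv : -1 *: v + u = u - v by rewrite scaleN1r addrC.
have Suv : -1 *: S t v + S t u = S t u - S t v by rewrite scaleN1r addrC.
rewrite uv Suv in lin.
have uvp : Lp nu p (u - v) by exact: Lp_sub.
have mS w : Lp nu p w -> mfun (S t w).
  by move=> wp; apply: Lp_measurable (semigroup_stable cS t0 wp).
have mD : mfun (S t u - S t v) by apply: measurable_funB; exact: mS.
have := LpN_triangle nu (measurable_funB mD (mS _ uvp)) (mS _ uvp) p1.
rewrite subrK [X in (_ <= X + _)%E]LpNB_sym lin add0e => /le_trans; apply.
exact: (semigroup_contraction cS).
Qed.

End contraction.

Context {H : normedModType R} (istar : (X -> R) -> H) (ip : {dot H for idfun})
  (B : H -> H) (T : R -> R -> (X -> R) -> (X -> R)).
Hypothesis OU : is_perturbed_OU istar ip B nu T.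

(** Below exponent 2 both semigroups are compared with [T 2] only on the square-integrable
    functions, and [f] need not be one of them; its bounded approximations are. *)
Lemma semigroup_consistent_small p q t f : 1 <= p -> p <= q -> q < 2 ->
  0 <= t -> Lp nu q f -> T p t f = T q t f %[ae nu].
Proof.
move=> p1 pq q2 t0 fq.
have q1 := le_trans p1 pq; have p2 := le_lt_trans pq q2.
have p0 : 0 < p by rewrite (lt_le_trans ltr01).
have fp := Lp_subset nu_fin p1 pq fq.
have Tp := pOU_semigroup OU p1; have Tq := pOU_semigroup OU q1.
have mp g : Lp nu p g -> mfun (T p t g).
  by move=> gp; apply: Lp_measurable (semigroup_stable Tp t0 gp).
have mq g : Lp nu q g -> mfun (T q t g).
  by move=> gp; apply: Lp_measurable (semigroup_stable Tq t0 gp).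
have [C C0 CN] := LpN_le nu_fin p1 pq.
apply: (LpNB0_ae p0); [exact: mp|exact: mq|].
apply/eqP; rewrite eq_le LpN_ge0 andbT.
apply/lee_addgt0Pr => e e0; rewrite add0e.
(* Replacing [f] by [h] costs [C * d] under [T p] and again under [T q]; the 1 keeps the denominator
   positive when [C = 0]. *)
pose d := e / (C + C + 1).
have d0 : 0 < d by rewrite divr_gt0// ltr_wpDl// addr_ge0.
have [h [mh [M hM] fh]] := bounded_dense_Lp q1 fq d0.
have hL r : 1 <= r -> Lp nu r h by move=> r1; exact: Lp_bounded hM.
have hpq : T p t h = T q t h %[ae nu].
  have h2 : Lp nu 2 h by apply: hL; rewrite ler1n.
  have := pOU_extend OU (p := p) _ t0 h2; rewrite p1 p2 => /(_ isT).
  have := pOU_extend OU (p := q) _ t0 h2; rewrite q1 q2 => /(_ isT).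
  move=> E1 E2; have := ae_and E1 E2.
  by apply: ae_imp => x [/(_ I) a /(_ I) b] _; rewrite a b.
have [hp hq] := (hL p p1, hL q q1).
have mfh : mfun (f - h) by apply: measurable_funB => //; exact: Lp_measurable fp.
have i1 := LpN_triangle_sub nu (mp _ fp) (mp _ hp) (mq _ fq) p1.
have i2 := LpN_triangle_sub nu (mp _ hp) (mq _ hq) (mq _ fq) p1.
have i3 := ae_LpNB0 p0 (mp _ hp) (mq _ hq) hpq.
have i4 := contraction_dist p1 Tp t0 fp hp.
have i5 := contraction_dist q1 Tq t0 hq fq.
have i6 := CN _ mfh.
have i7 := CN _ (measurable_funB (mq _ hq) (mq _ fq)).
have Cd : (C%:E * LpN nu q (f - h)%R <= (C * d)%:E)%E.
  by rewrite EFinM; exact: lee_wpmul2l.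
have b1 : (LpN nu p (T p t f - T p t h)%R <= (C * d)%:E)%E.
  exact: le_trans (le_trans i4 i6) Cd.
have b2 : (LpN nu p (T q t h - T q t f)%R <= (C * d)%:E)%E.
  apply: le_trans i7 (le_trans _ Cd); apply: lee_wpmul2l; rewrite ?lee_fin//.
  by rewrite [X in (_ <= X)%E]LpNB_sym.
apply: le_trans i1 _; apply: le_trans (leeD b1 (le_trans i2 _)) _.
  by rewrite i3 add0e; exact: b2.
rewrite -EFinD lee_fin -mulrDl /d mulrA ler_pdivrMr; last first.
  by rewrite ltr_wpDl// addr_ge0.
by rewrite mulrC ler_pM2l// lerDl.
Qed.

Lemma semigroup_consistent p q t f : 1 <= p -> p <= q -> 0 <= t ->
  Lp nu q f -> T p t f = T q t f %[ae nu].
Proof.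
move=> p1 pq t0 fq; have q1 := le_trans p1 pq.
have [q2|q2] := ltP q 2; first exact: semigroup_consistent_small.
have f2 : Lp nu 2 f by apply: Lp_subset fq => //; rewrite ler1n.
have Tq2 : T q t f = T 2 t f %[ae nu].
  move: q2; rewrite le_eqVlt => /predU1P[<-|q2]; last first.
    exact: (pOU_restrict OU q2 t0 fq).
  by apply: aeW.
have Tp2 : T p t f = T 2 t f %[ae nu].
  have [p2|p2|->] := ltgtP p 2; last by apply: aeW.
    by apply: (pOU_extend OU _ t0 f2); rewrite p1 p2.
  by apply: (pOU_restrict OU) => //; exact: Lp_subset fq.
have := ae_and Tp2 Tq2.
by apply: ae_imp => x [/(_ I) a /(_ I) b] _; rewrite a b.
Qed.

Lemma generator_subset p q u g : 1 <= p -> p <= q ->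
  generator (Lp nu q) (LpN nu q) (T q) u g ->
  generator (Lp nu p) (LpN nu p) (T p) u g.
Proof.
move=> p1 pq [uq gq lim]; have q1 := le_trans p1 pq.
have [up gp] := (Lp_subset nu_fin p1 pq uq, Lp_subset nu_fin p1 pq gq).
split=> //; have [C C0 CN] := LpN_le nu_fin p1 pq.
apply: cvge0_le_scale lim; first by move=> x; exact: LpN_ge0.
near=> t; have t0 : 0 <= t by near: t; exact: nbhs_right_ge.
have Tp := semigroup_stable (pOU_semigroup OU p1) t0 up.
have Tq := semigroup_stable (pOU_semigroup OU q1) t0 uq.
have lq : Lp nu q (t^-1 *: (T q t u - u) - g).
  by apply: Lp_sub => //; apply: Lp_scale => //; exact: Lp_sub.
have lp : Lp nu p (t^-1 *: (T p t u - u) - g).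
  by apply: Lp_sub => //; apply: Lp_scale => //; exact: Lp_sub.
apply: le_trans (CN _ (Lp_measurable lq)).
rewrite le_eqVlt; apply/orP; left; apply/eqP.
apply: LpN_ae (Lp_measurable lp) (Lp_measurable lq) _.
have := semigroup_consistent p1 pq t0 uq.
by apply: ae_imp => x /(_ I) e _; rewrite !fctE e.
Unshelve. all: by end_near. Qed.

Lemma generator_unique p u g h : 1 <= p ->
  generator (Lp nu p) (LpN nu p) (T p) u g ->
  generator (Lp nu p) (LpN nu p) (T p) u h -> g = h %[ae nu].
Proof.
move=> p1 [up gp limg] [_ hp limh].
have p0 : 0 < p by rewrite (lt_le_trans ltr01).
apply: (LpNB0_ae p0 (Lp_measurable gp) (Lp_measurable hp)).
apply/eqP; rewrite eq_le LpN_ge0 andbT.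
apply/lee_addgt0Pr => e e0; rewrite add0e.
have e20 : 0 < e / 2 by rewrite divr_gt0.
have [t [t0 gt ht]] : exists t : R, [/\ 0 <= t,
    (LpN nu p (t^-1 *: (T p t u - u) - g)%R < (e / 2)%:E)%E &
    (LpN nu p (t^-1 *: (T p t u - u) - h)%R < (e / 2)%:E)%E].
  apply: (@filter_ex _ (0^'+)); near=> t; split.
  - by near: t; exact: nbhs_right_ge.
  - by near: t; exact: cvge0_lt.
  - by near: t; exact: cvge0_lt.
have mT : mfun (t^-1 *: (T p t u - u)).
  apply: (@Lp_measurable _ _ nu p); apply: Lp_scale => //; apply: Lp_sub => //.
  exact: (semigroup_stable (pOU_semigroup OU p1)).
have := LpN_triangle_sub nu (Lp_measurable gp) mT (Lp_measurable hp) p1.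
move=> /le_trans; apply; rewrite [e in X in (_ <= X)%E]splitr EFinD.
by apply: leeD; apply: ltW => //; rewrite LpNB_sym.
Unshelve. all: by end_near. Qed.

End consistency.

(** * The energy identity *)

Section cylindrical_functions.
Context {R : realType} {X H : normedModType R} (istar : (X -> R) -> H)
  (ip : {dot H for idfun}).
Hypothesis ip_norm : forall h, ip h h = `|h| ^+ 2.
Local Notation mfun f := (measurable_fun [set: borel X] (f : borel X -> R)).

Lemma continuous_row n (xs : 'I_n -> X -> R) : (forall j, continuous (xs j)) ->
  continuous (fun x => \row_j xs j x : 'rV[R]_n).
Proof.
move=> cxs x A [P Pn PA].
suff : \forall y \near x, forall i j, P i j ((\row_j xs j y) i j).
  by apply: filterS => y Py; apply: PA.
apply: filter_forall => i.
apply: (@filter_forall _ _ (fun j y => P i j ((\row_j xs j y) i j))) => j.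
have Pij := Pn i j; rewrite mxE in Pij.
have near_P : \forall y \near x, P i j (xs j y) by exact: (cxs j x _ Pij).
by apply: filterS near_P => y; rewrite mxE.
Qed.

Lemma measurable_sum_fun (I : Type) (s : seq I) (h : I -> X -> R) :
  (forall j, mfun (h j)) -> mfun (fun x => \sum_(j <- s) h j x).
Proof.
move=> mh; elim: s => [|j s IHs].
  by rewrite (_ : (fun x => _) = cst 0)//; apply/funext => x; rewrite big_nil.
rewrite (_ : (fun x => _) = (fun x => h j x + \sum_(j <- s) h j x)).
  exact: measurable_funD.
by apply/funext => x; rewrite big_cons.
Qed.

Lemma cyl_gradient_measurable f (F : X -> H) : cyl_gradient istar f F -> mfun f.
Proof.
move=> [n [phi [xs [[cphi _ _] dxs -> _]]]].
apply: continuous_borel_measurable => x.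
apply: (continuous_comp (f := fun x => \row_j xs j x : 'rV[R]_n)); last exact: cphi.
by apply: continuous_row => j; have [] := dxs j.
Qed.

(** [F] is a combination of finitely many fixed vectors with continuous coefficients, so only
    pairings of [k] with fixed vectors matter. *)
Lemma cyl_gradient_ip_measurable f (F : X -> H) (k : X -> H) :
  cyl_gradient istar f F -> (forall h, mfun (fun x => ip (k x) h)) ->
  mfun (fun x => ip (k x) (F x)).
Proof.
move=> [n [phi [xs [[_ _ dphi] dxs _ ->]]]] mk.
have E : (fun x => ip (k x) (\sum_j
      'D_(delta_mx 0 j : 'rV[R]_n) phi (\row_k xs k x) *: istar (xs j))) =
    (fun x => \sum_j 'D_(delta_mx 0 j : 'rV[R]_n) phi (\row_k xs k x) *
      ip (k x) (istar (xs j))).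
  apply/funext => x.
  have ip0 : ip (k x) 0 = 0 by rewrite -(scale0r 0) ipZr mul0r.
  rewrite (big_morph (fun v => ip (k x) v) (ipDr ip (k x)) ip0).
  by apply: eq_bigr => j _; rewrite ipZr.
rewrite E; apply: measurable_sum_fun => j; apply: measurable_funM; last exact: mk.
apply: continuous_borel_measurable => x.
have [_ dc _] := dphi j.
apply: (@continuous_comp _ _ _ (fun x => \row_j xs j x : 'rV[R]_n)
  ('D_(delta_mx 0 j : 'rV[R]_n) phi)); last exact: dc.
by apply: continuous_row => l; have [] := dxs l.
Qed.

Lemma borel_comp_measurable (v : X -> H) (phi : H -> R) :
  measurable_fun [set: borel X] (v : borel X -> borel H) -> continuous phi ->
  mfun (phi \o v).
Proof.
move=> mv cphi; have mphi := continuous_borel_measurable cphi.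
exact: (measurableT_comp mphi mv).
Qed.

Lemma continuous_ipr (h : H) : continuous (fun v => ip v h).
Proof. by apply: (continuous_ip ip_norm) => x; [exact: cvg_id|exact: cvg_cst]. Qed.

(** In general a difference of Borel maps into a normed space need not be Borel. The norm is
    therefore expanded into inner products, each measurable because [F] is finite-dimensional or [v]
    is composed with a continuous function. *)
Lemma cyl_gradient_dist_measurable f (F v : X -> H) : cyl_gradient istar f F ->
  measurable_fun [set: borel X] (v : borel X -> borel H) ->
  mfun (fun x => `|F x - v x|).
Proof.
move=> fF mv.
have mFF : mfun (fun x => ip (F x) (F x)).
  apply: (cyl_gradient_ip_measurable fF) => h.
  rewrite (_ : (fun x => _) = (fun x => ip h (F x))); last first.
    by apply/funext => x; rewrite ipC.
  by apply: (cyl_gradient_ip_measurable fF (k := fun=> h)) => h'.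
have mvF : mfun (fun x => ip (v x) (F x)).
  apply: (cyl_gradient_ip_measurable fF) => h.
  exact: (borel_comp_measurable mv (@continuous_ipr h)).
have mvv : mfun (fun x => ip (v x) (v x)).
  apply: (borel_comp_measurable mv (phi := fun h => ip h h)).
  by apply: (continuous_ip ip_norm) => x; exact: cvg_id.
rewrite (_ : (fun x => _) = Num.sqrt \o
    (fun x => ip (F x) (F x) - 2 * ip (v x) (F x) + ip (v x) (v x))).
  apply: measurableT_comp.
    by apply: continuous_measurable_fun; apply: sqrt_continuous.
  apply: measurable_funD => //; apply: measurable_funB => //.
  exact: measurable_funM.
apply/funext => x /=; rewrite !ip_norm (ipC ip (v x)) -(ip_normB ip_norm).
by rewrite sqrtr_sqr normr_id.
Qed.

End cylindrical_functions.

Section energy.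
Context {R : realType} {X H : normedModType R} (istar : (X -> R) -> H)
  (ip : {dot H for idfun}) (B : {linear H -> H}).
Variable nu : {measure set (borel X) -> \bar R}.
Hypotheses (ip_norm : forall h, ip h h = `|h| ^+ 2) (B_continuous : continuous B)
  (B_coercive : forall h, `|h| ^+ 2 <= - 2 * ip (B h) h).
Local Notation mfun f := (measurable_fun [set: borel X] (f : borel X -> R)).

Lemma Lp_fineK p f : Lp nu p f -> LpN nu p f = (fine (LpN nu p f))%:E.
Proof. by move=> /Lp_finite h; rewrite fineK// ge0_fin_numE// LpN_ge0. Qed.

Lemma integral_mul_le (a b c : X -> R) (K : R) : 0 <= K -> Lp nu 2 a -> Lp nu 2 b ->
  mfun c -> (forall x, `|c x| <= K * `|a x * b x|) ->
  nu.-integrable setT (EFin \o (c : borel X -> R)) /\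
  `|\int[nu]_(x in [set: borel X]) c x| <=
    K * (fine (LpN nu 2 a) * fine (LpN nu 2 b)).
Proof.
move=> K0 a2 b2 mc cab; have [ma mb] := (Lp_measurable a2, Lp_measurable b2).
have mc' : measurable_fun setT (EFin \o (c : borel X -> R)).
  by move/measurable_EFinP : mc.
have mab : measurable_fun setT (fun x : borel X => `|(a x * b x)%:E|%E).
  have /measurable_EFinP h := measurable_funM ma mb.
  exact: measurableT_comp.
have mc'' : measurable_fun setT (fun x : borel X => `|(c x)%:E|%E).
  exact: measurableT_comp.
have iab : nu.-integrable setT (EFin \o ((a : borel X -> R) \* b)).
  by apply/Lfun1_integrable; exact: Lfun2_mul_Lfun1.
have iKab : nu.-integrable setT (fun x : borel X => K%:E * (a x * b x)%:E)%E.
  exact: (integrableZl measurableT K iab).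
have ic : nu.-integrable setT (EFin \o (c : borel X -> R)).
  apply: (le_integrable measurableT _ _ iKab); first exact: mc'.
  by move=> x _; rewrite /= lee_fin normrM (ger0_norm K0); exact: cab.
split=> //; rewrite -lee_fin EFin_normr_Rintegral//.
apply: le_trans (le_abse_integral nu measurableT mc') _.
rewrite !EFinM -!Lp_fineK//.
have := @hoelder _ _ _ nu a b 2 2 ma mb.
rewrite ltr0n => /(_ isT isT) H2.
have {}H2 := H2 ltac:(by rewrite [RHS]splitr !div1r).
apply: le_trans (lee_wpmul2l _ H2); last by rewrite lee_fin.
rewrite Lnorm1 -ge0_integralZl//.
apply: ge0_le_integral => //.
- exact: measurable_funeM.
by move=> x _; rewrite /= -EFinM lee_fin.
Qed.

(** The operator is tested on cylindrical functions only, so [v = u] is reached by approximation in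
    the graph norm. Coercivity then bounds the square of the gradient norm by [2 |g| |u|], hence by
    [(|u| + |g|)^2]. *)
Lemma L2_op_energy u g : L2_op istar ip B nu u g -> exists2 Du,
  DH istar nu 2 u Du & (LpHN nu 2 Du <= LpN nu 2 u + LpN nu 2 g)%E.
Proof.
move=> [Du DHu [g2 form]]; exists Du => //.
have [u2 [mDu Du_fin] [f [F [fF fu FDu]]]] := DHu.
have [K K0 BK] := continuous_linear_norm_bound B_continuous.
pose a : X -> R := fun x => `|Du x|.
have ma : mfun a.
  by apply: (borel_comp_measurable mDu) => h; apply: cvg_norm; exact: cvg_id.
have a2 : Lp nu 2 a by apply/LpP.
have mBDu h : mfun (fun x => ip (B (Du x)) h).
  apply: (borel_comp_measurable mDu (phi := fun v => ip (B v) h)).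
  by apply: (continuous_ip ip_norm) => //= x; exact: cvg_cst.
have mBDuDu : mfun (fun x => ip (B (Du x)) (Du x)).
  apply: (borel_comp_measurable mDu (phi := fun v => ip (B v) v)).
  by apply: (continuous_ip ip_norm) => //= x; exact: cvg_id.
have Bip k h : `|ip (B k) h| <= K * (`|k| * `|h|).
  apply: le_trans (ip_cauchy_schwarz ip_norm _ _) _.
  by rewrite mulrA ler_wpM2r.
have [iBDu _] : nu.-integrable setT
    (EFin \o (fun x : borel X => ip (B (Du x)) (Du x))) /\
    `|\int[nu]_(x in [set: borel X]) ip (B (Du x)) (Du x)| <=
    K * (fine (LpN nu 2 a) * fine (LpN nu 2 a)).
  apply: integral_mul_le => // x; apply: le_trans (Bip _ _) _.
  by rewrite ler_wpM2l// normrM /a !normr_id.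
have mg := Lp_measurable g2; have mu' := Lp_measurable u2.
have [igu gu_le] : nu.-integrable setT (EFin \o (fun x : borel X => g x * u x)) /\
    `|\int[nu]_(x in [set: borel X]) (g x * u x)| <=
    1 * (fine (LpN nu 2 g) * fine (LpN nu 2 u)).
  by apply: integral_mul_le => // [|x]; [exact: measurable_funM|rewrite mul1r].
pose I1 := \int[nu]_(x in [set: borel X]) ip (B (Du x)) (Du x).
pose I2 := \int[nu]_(x in [set: borel X]) (g x * u x).
have I12 : I1 = I2.
  apply/eqP; rewrite -subr_eq0 -normr_le0; apply/ler_addgt0Pr => e e0; rewrite add0r.
  (* An approximation within [d] changes the form by at most [K * |a| * d] and the right-hand
     integral by at most [|g| * d]. *)
  pose C := K * fine (LpN nu 2 a) + fine (LpN nu 2 g) + 1.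
  have na0 : 0 <= fine (LpN nu 2 a) by rewrite fine_ge0// LpN_ge0.
  have ng0 : 0 <= fine (LpN nu 2 g) by rewrite fine_ge0// LpN_ge0.
  have C0 : 0 < C by rewrite /C ltr_wpDl// addr_ge0// mulr_ge0.
  pose d := e / C; have d0 : 0 < d by rewrite divr_gt0.
  have [n [fn Fn]] : exists n, (LpN nu 2 (f n - u)%R < d%:E)%E /\
      (LpHN nu 2 (F n - Du)%R < d%:E)%E.
    by apply: (@filter_ex _ \oo); near=> n; split; near: n; exact: cvge0_lt.
  have cfF := fF n; pose b : X -> R := fun x => `|F n x - Du x|.
  have mb : mfun b by exact: (cyl_gradient_dist_measurable ip_norm cfF mDu).
  have bE : LpN nu 2 b = LpHN nu 2 (F n - Du) by [].
  have b2 : Lp nu 2 b by apply/LpP; split => //; rewrite bE; exact: lt_trans Fn (ltry _).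
  have mf := cyl_gradient_measurable cfF.
  have mfu : mfun (f n - u) by exact: measurable_funB.
  have fu2 : Lp nu 2 (f n - u) by apply/LpP; split => //; exact: lt_trans fn (ltry _).
  have mBF : mfun (fun x => ip (B (Du x)) (F n x)).
    exact: (cyl_gradient_ip_measurable cfF mBDu).
  have [i1 le1] : nu.-integrable setT
      (EFin \o (fun x : borel X => ip (B (Du x)) (F n x) - ip (B (Du x)) (Du x))) /\
      `|\int[nu]_(x in [set: borel X])
         (ip (B (Du x)) (F n x) - ip (B (Du x)) (Du x))| <=
      K * (fine (LpN nu 2 a) * fine (LpN nu 2 b)).
    apply: integral_mul_le => // [|x]; first exact: measurable_funB.
    rewrite -ipBr; apply: le_trans (Bip _ _) _.
    by rewrite ler_wpM2l// normrM /a /b !normr_id.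
  have [i2 le2] : nu.-integrable setT
      (EFin \o (fun x : borel X => g x * (f n - u) x)) /\
      `|\int[nu]_(x in [set: borel X]) (g x * (f n - u) x)| <=
      1 * (fine (LpN nu 2 g) * fine (LpN nu 2 (f n - u))).
    by apply: integral_mul_le => // [|x]; [exact: measurable_funM|rewrite mul1r].
  have E1 : \int[nu]_(x in [set: borel X]) ip (B (Du x)) (F n x) =
      \int[nu]_(x in [set: borel X])
         (ip (B (Du x)) (F n x) - ip (B (Du x)) (Du x)) + I1.
    rewrite -RintegralD//; apply: eq_Rintegral => x _; by rewrite subrK.
  have E2 : \int[nu]_(x in [set: borel X]) (g x * f n x) =
      \int[nu]_(x in [set: borel X]) (g x * (f n - u) x) + I2.
    rewrite -RintegralD//; apply: eq_Rintegral => x _.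
    by rewrite (_ : (f n - u) x = f n x - u x)// mulrBr subrK.
  have := form _ _ cfF; rewrite /dirichlet_form => /oppr_inj; rewrite E1 E2 => E12.
  have bd : fine (LpN nu 2 b) <= d.
    by rewrite -lee_fin -Lp_fineK// bE; exact: ltW.
  have fd : fine (LpN nu 2 (f n - u)) <= d.
    by rewrite -lee_fin -Lp_fineK//; exact: ltW.
  have -> : I1 - I2 = \int[nu]_(x in [set: borel X]) (g x * (f n - u) x) -
    \int[nu]_(x in [set: borel X]) (ip (B (Du x)) (F n x) - ip (B (Du x)) (Du x)).
    by move: E12; lra.
  apply: le_trans (ler_normB _ _) _; apply: le_trans (lerD le2 le1) _.
  have h1 := ler_wpM2l ng0 fd.
  have h2 := ler_wpM2l (mulr_ge0 K0 na0) bd.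
  have -> : e = C * d by rewrite /d mulrC divfK ?gt_eqF.
  by rewrite /C; move: h1 h2 d0; rewrite mul1r mulrA; lra.
have sqE : fine (LpN nu 2 a) ^+ 2 = \int[nu]_(x in [set: borel X]) (a x ^+ 2).
  rewrite /Rintegral -powR_mulrn ?fine_ge0 ?LpN_ge0// -fine_poweR; congr fine.
  rewrite /LpN poweR_Lnorm ?pnatr_eq0//; apply: eq_integral => x _.
  rewrite -[a x ^+ 2]real_normK ?num_real//; congr EFin.
  exact: (powR_mulrn 2 (normr_ge0 (a x))).
have ia2 : nu.-integrable setT (EFin \o (fun x : borel X => a x ^+ 2)).
  exact: Lfun2_integrable_sqr.
have aI : fine (LpN nu 2 a) ^+ 2 <= - 2 * I1.
  rewrite sqE /I1 -RintegralZl//; apply: le_Rintegral => //.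
    exact: (integrableZl measurableT (- 2) iBDu).
  by move=> x _; exact: B_coercive.
have un0 : 0 <= fine (LpN nu 2 u) by rewrite fine_ge0// LpN_ge0.
have gn0 : 0 <= fine (LpN nu 2 g) by rewrite fine_ge0// LpN_ge0.
rewrite [LpHN _ _ _](_ : _ = LpN nu 2 a)// (Lp_fineK a2) (Lp_fineK u2) (Lp_fineK g2).
rewrite -EFinD lee_fin -(@ler_pXn2r _ 2) ?nnegrE ?addr_ge0 ?fine_ge0 ?LpN_ge0//.
apply: le_trans aI _; rewrite I12.
move: gu_le; rewrite mul1r ler_norml -/I2 => /andP[gu_le _].
have := sqr_ge0 (fine (LpN nu 2 u)); have := sqr_ge0 (fine (LpN nu 2 g)).
have := mulr_ge0 gn0 un0; rewrite sqrrD mulr2n; move: gu_le; lra.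
Unshelve. all: by end_near. Qed.

End energy.

Theorem proposition3p8 (R : realType) (X : completeNormedModType R)
  (Q : (X -> R) -> X) (DA : set X) (A : X -> X) (etA : R -> X -> X)
  (Qt : R -> (X -> R) -> X) (Qinf : (X -> R) -> X)
  (mu : probability (borel X) R)
  (H : completeNormedModType R) (ip : {dot H for idfun})
  (i : {linear H -> X}) (istar : (X -> R) -> H) (B : {linear H -> H})
  (U : X -> \bar R) (nu : {measure set (borel X) -> \bar R})
  (T : R -> R -> (X -> R) -> (X -> R))
  (X_separable : separable X)
  (* (1) *)
  (Q_sym_nonneg : sym_nonneg_operator Q)
  (etA_semigroup : banach_semigroup etA)
  (A_generates : generates DA A etA)
  (* (2) *)
  (Qt_def : is_Qt Q etA Qt)
  (Qt_gaussian : forall t : R, 0 < t -> exists2 gamma : probability (borel X) R,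
     centred_gaussian gamma & is_covariance gamma (Qt t))
  (Qinf_def : forall f g, dualspace f -> dualspace g ->
     g (Qt t f) @[t --> +oo] --> g (Qinf f))
  (mu_gaussian : nondegenerate_centred_gaussian mu)
  (mu_covariance : is_covariance mu Qinf)
  (* the reproducing kernel Hilbert space of Q *)
  (H_rkhs : is_rkhs Q ip i istar)
  (* (3) *)
  (QinfA_bounded : exists2 c : R, 0 < c & forall f g, adjoint_op DA A f g ->
     exists2 h : H, i h = Qinf g & `|h| <= c * `|istar f|)
  (B_continuous : continuous B)
  (B_def : forall f g, adjoint_op DA A f g -> i (B (istar f)) = Qinf g)
  (* (4) *)
  (U_admissible : admissible_potential istar mu U)
  (nu_def : weighted_measure mu U nu)
  (T_perturbed_OU : is_perturbed_OU istar ip B nu T) :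
  let L p := generator (Lp nu p) (LpN nu p) (T p) in
  (forall p q : R, 1 < p -> 1 < q -> p < q ->
     [/\ dom (L q) `<=` dom (L p),
         exists C : R, forall u gq gp, L q u gq -> L p u gp ->
           (LpN nu p u + LpN nu p gp <= C%:E * (LpN nu q u + LpN nu q gq))%E &
         forall u gq gp, L q u gq -> L p u gp -> gq = gp %[ae nu]]) /\
  (forall p : R, 2 <= p ->
     dom (L p) `<=` W1 istar nu 2 /\
     exists C : R, forall u g, L p u g ->
       exists2 Du, DH istar nu 2 u Du &
         (LpN nu 2 u + LpHN nu 2 Du <= C%:E * (LpN nu p u + LpN nu p g))%E).
Proof.
have nu_fin := weighted_gaussian_finite (proj1 mu_gaussian) U_admissible nu_def.
have ip_norm := rkhs_norm H_rkhs.
have B_coercive := coercivity etA_semigroup A_generates Qt_def Qinf_def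
  mu_covariance H_rkhs B_continuous B_def.
move=> L; have sub (p q : R) u g : 1 <= p -> p <= q -> L q u g -> L p u g.
  by move=> p1 pq; exact: (generator_subset nu_fin T_perturbed_OU p1 pq).
have uniq (p : R) u g h : 1 <= p -> L p u g -> L p u h -> g = h %[ae nu].
  by move=> p1; exact: (generator_unique T_perturbed_OU p1).
have LLp p u g : L p u g -> Lp nu p u /\ Lp nu p g by case.
have L2E u g : L 2 u g -> L2_op istar ip B nu u g.
  by move=> /(pOU_generator2 T_perturbed_OU).
clearbody L.
split=> [p q p1 q1 pq|p p2].
  have [/ltW {}p1 /ltW {}pq] := (p1, pq).
  have sub_ae u gq gp : L q u gq -> L p u gp -> gq = gp %[ae nu].
    by move=> Lq; exact: (uniq p _ _ _ p1 (sub p q _ _ p1 pq Lq)).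
  split=> //; first by move=> u [g Lg]; exists g; exact: (sub p q _ _ p1 pq Lg).
  have [C C0 CN] := LpN_le nu_fin p1 pq.
  exists C => u gq gp Lq Lp; have [uq gqq] := LLp _ _ _ Lq; have [_ gpp] := LLp _ _ _ Lp.
  have [mu' mgq] := (Lp_measurable uq, Lp_measurable gqq).
  (* The two generator values agree almost everywhere, so both terms of the graph norm involve the
     same functions in the two spaces. *)
  rewrite -(LpN_ae p mgq (Lp_measurable gpp) (sub_ae _ _ _ Lq Lp)).
  by rewrite ge0_muleDr ?LpN_ge0// leeD// CN.
have energy u g : L p u g -> exists2 Du,
    DH istar nu 2 u Du & (LpHN nu 2 Du <= LpN nu 2 u + LpN nu 2 g)%E.
  move=> Lpu; have L2u := sub 2 p u g (ler1n R 2) p2 Lpu.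
  exact: (L2_op_energy ip_norm B_continuous B_coercive (L2E _ _ L2u)).
split; first by move=> u [g /energy[Du DHu _]]; exists Du.
have [C C0 CN] := LpN_le nu_fin (ler1n R 2) p2.
(* One [C] pays for the norm of [u], the other for the gradient, which the energy estimate bounds by
   the graph norm at exponent 2. *)
exists (2 * C) => u g Lpu; have [Du DHu le] := energy _ _ Lpu; exists Du => //.
have [up gp] := LLp _ _ _ Lpu.
have N2 : (LpN nu 2 u + LpN nu 2 g <= C%:E * (LpN nu p u + LpN nu p g))%E.
  rewrite ge0_muleDr ?LpN_ge0//.
  by rewrite leeD// CN//; [exact: Lp_measurable up|exact: Lp_measurable gp].
have E2 : ((2 * C)%:E = C%:E + C%:E)%E by rewrite -EFinD; congr EFin; ring.
rewrite E2 ge0_muleDl ?lee_fin//; apply: leeD; last exact: le_trans le N2.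
by apply: le_trans N2; rewrite leeDl// LpN_ge0.
Qed.
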